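(* For every prime $p\ge3$ and every integer $n\ge2$, let $\mathcal{A}_{p,n}=\mathbb{F}_p[[x_0,\dots,x_n]]/(x_0^2+x_1^2+\cdots+x_n^2)$. Then \[ e_{HK}(\mathcal{A}_{p,n})\ \ge\ 1+\frac{E_n}{n!}. \]
   Context: For a local ring $(R,\mathfrak m)$ of characteristic $p>0$, the Hilbert–Kunz multiplicity is $e_{HK}(R)=\lim_{e\to\infty}\lambda(R/\mathfrak m^{[p^e]})/p^{e\dim R}$, where $\lambda$ is length and $\mathfrak m^{[p^e]}$ is the ideal generated by the $p^e$-th powers of elements of $\mathfrak m$. $E_n$ is the Euler number, i.e. the number of linear extensions of the zigzag poset $z_1>z_2<z_3>\cdots$ on $n$ elements, with $\sum_n E_n z^n/n!=\tan z+\sec z$. *)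

(* Defs.v *)
From HB Require Import structures.
From mathcomp Require Import all_boot all_order perm all_algebra.
From mathcomp Require boolp.
From mathcomp Require mpoly.

Set Implicit Arguments.
Unset Strict Implicit.
Unset Printing Implicit Defensive.

Import GRing.Theory.
Local Open Scope ring_scope.

(* The notations of mpoly are incompatible with those of classical_sets: they
   are confined to this module, which is closed before the latter is loaded. *)
Module PowerSeries.
Import mpoly.

Record mpseries (n : nat) (R : Type) :=
  MPSeries { pscoef : 'X_{1..n} -> R }.

HB.instance Definition _ n R := boolp.gen_eqMixin (mpseries n R).
HB.instance Definition _ n R := boolp.gen_choiceMixin (mpseries n R).

Section Ring.
Variables (n : nat) (R : comNzRingType).
Implicit Types f g h : mpseries n R.

Lemma pseriesP f g : pscoef f =1 pscoef g -> f = g.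
Proof. by case: f g => [f] [g] /= /boolp.funext ->. Qed.

Definition psadd f g := MPSeries (fun m => pscoef f m + pscoef g m).
Definition psopp f := MPSeries (fun m => - pscoef f m).
Definition psconst (c : R) : mpseries n R :=
  MPSeries (fun m => if m == 0%MM then c else 0).
Definition psX (i : 'I_n) : mpseries n R :=
  MPSeries (fun m => (m == U_(i)%MM)%:R).
(* Cauchy product; two exponents adding up to m have degree at most mdeg m. *)
Definition psmul f g := MPSeries (fun m =>
  \sum_(k : 'X_{1..n < (mdeg m).+1, (mdeg m).+1} | m == (k.1 + k.2)%MM)
    pscoef f k.1 * pscoef g k.2).

Fact psaddA : associative psadd.
Proof. by move=> f g h; apply: pseriesP => m /=; rewrite addrA. Qed.
Fact psaddC : commutative psadd.
Proof. by move=> f g; apply: pseriesP => m /=; rewrite addrC. Qed.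
Fact psadd0 : left_id (psconst 0) psadd.
Proof. by move=> f; apply: pseriesP => m /=; rewrite if_same add0r. Qed.
Fact psaddN : left_inverse (psconst 0) psopp psadd.
Proof. by move=> f; apply: pseriesP => m /=; rewrite if_same addNr. Qed.
HB.instance Definition _ :=
  GRing.isZmodule.Build (mpseries n R) psaddA psaddC psadd0 psaddN.

Definition pstrunc (d : nat) f : {mpoly R[n]} :=
  \sum_(m : 'X_{1..n < d}) pscoef f m *: 'X_[m].

Lemma pstruncE (d : nat) f m : (mdeg m < d)%N -> (pstrunc d f)@_m = pscoef f m.
Proof.
move=> md; rewrite raddf_sum /= (bigD1 (BMultinom md)) //=.
rewrite mcoeffZ mcoeffX eqxx mulr1 big1 ?addr0 // => i ne.
by rewrite mcoeffZ mcoeffX -[_ == _ :> 'X_{1..n}]/(i == BMultinom md)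
  (negPf ne) mulr0.
Qed.

Lemma psmul_trunc f g m (P Q : {mpoly R[n]}) :
    (forall k, (mdeg k <= mdeg m)%N -> P@_k = pscoef f k) ->
    (forall k, (mdeg k <= mdeg m)%N -> Q@_k = pscoef g k) ->
  pscoef (psmul f g) m = (P * Q)@_m.
Proof.
move=> HP HQ; rewrite mcoeffM /=; apply: eq_bigr => -[k1 k2] /= _.
by rewrite HP ?HQ // -ltnS bmdeg.
Qed.

Fact psmulA : associative psmul.
Proof.
move=> f g h; apply: pseriesP => m; pose t := pstrunc (mdeg m).+1.
have tE u k : (mdeg k <= mdeg m)%N -> (t u)@_k = pscoef u k.
  by move=> km; rewrite pstruncE.
have tM u v k : (mdeg k <= mdeg m)%N -> (t u * t v)@_k = pscoef (psmul u v) k.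
  move=> km; rewrite (psmul_trunc (P := t u) (Q := t v)) // => j jk;
    by rewrite tE // (leq_trans jk).
rewrite (psmul_trunc (P := t f) (Q := t g * t h)); try by [exact: tE|exact: tM].
rewrite (psmul_trunc (P := t f * t g) (Q := t h)); try by [exact: tE|exact: tM].
by rewrite mulrA.
Qed.

Fact psmulC : commutative psmul.
Proof.
move=> f g; apply: pseriesP => m; pose t := pstrunc (mdeg m).+1.
have tE u k : (mdeg k <= mdeg m)%N -> (t u)@_k = pscoef u k.
  by move=> km; rewrite pstruncE.
by rewrite !(psmul_trunc (tE _) (tE _)) mulrC.
Qed.

Fact psmul1 : left_id (psconst 1) psmul.
Proof.
move=> f; apply: pseriesP => m; pose t := pstrunc (mdeg m).+1.
have tE u k : (mdeg k <= mdeg m)%N -> (t u)@_k = pscoef u k.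
  by move=> km; rewrite pstruncE.
rewrite (@psmul_trunc (psconst 1) f m 1 (t f)) ?mul1r => [|k _|]; try exact: tE.
by rewrite mcoeff1 /=; case: eqP.
Qed.

Fact psmulDl : left_distributive psmul psadd.
Proof.
move=> f g h; apply: pseriesP => m /=; rewrite -big_split /=.
by apply: eq_bigr => k _; rewrite mulrDl.
Qed.

Fact psone_neq0 : psconst 1 != psconst 0.
Proof.
apply/eqP => /(congr1 (fun f => pscoef f 0%MM)) /=; rewrite eqxx.
by apply/eqP/oner_neq0.
Qed.

HB.instance Definition _ := GRing.Zmodule_isComNzRing.Build (mpseries n R)
  psmulA psmulC psmul1 psmulDl psone_neq0.

Lemma pscoefD f g m : pscoef (f + g) m = pscoef f m + pscoef g m.
Proof. by []. Qed.

Lemma pscoefM_trunc f g m d : (mdeg m < d)%N ->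
  pscoef (f * g) m = (pstrunc d f * pstrunc d g)@_m.
Proof.
by move=> md; apply: psmul_trunc => k km; rewrite pstruncE // (leq_ltn_trans km).
Qed.

Definition pscoef0 f : R := pscoef f 0%MM.

Fact pscoef0_is_zmod_morphism : zmod_morphism pscoef0.
Proof. by []. Qed.
Fact pscoef0_is_monoid_morphism : monoid_morphism pscoef0.
Proof.
split=> [|f g]; first by rewrite /pscoef0 /= eqxx.
rewrite /pscoef0 (@pscoefM_trunc _ _ _ 1) ?mdeg0 //.
by rewrite -[LHS]/(mcoeff 0%MM _) rmorphM /= !pstruncE ?mdeg0.
Qed.
HB.instance Definition _ := GRing.isZmodMorphism.Build (mpseries n R) R
  pscoef0 pscoef0_is_zmod_morphism.
HB.instance Definition _ := GRing.isMonoidMorphism.Build (mpseries n R) R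
  pscoef0 pscoef0_is_monoid_morphism.

Lemma pscoef0D f g : pscoef0 (f + g) = pscoef0 f + pscoef0 g.
Proof. exact: rmorphD. Qed.

Lemma pscoef0M f g : pscoef0 (f * g) = pscoef0 f * pscoef0 g.
Proof. exact: rmorphM. Qed.

Lemma pscoef0B f g : pscoef0 (f - g) = pscoef0 f - pscoef0 g.
Proof. exact: rmorphB. Qed.

Lemma pscoef0X i : pscoef0 (psX i) = 0.
Proof. by rewrite /pscoef0 /= eq_sym mnm1_eq0. Qed.

Lemma pscoef_exp_small u k m :
  pscoef0 u = 0 -> (mdeg m < k)%N -> pscoef (u ^+ k) m = 0.
Proof.
move=> u0; elim: k m => // k IH m mk; rewrite exprS /=.
apply: big1 => -[k1 k2] /= /eqP mE.
have [k10|k1n0] := eqVneq (bmnm k1) 0%MM.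
  by rewrite k10 -/(pscoef0 u) u0 mul0r.
have lt2 : (mdeg k2 < mdeg (k1 + k2))%N.
  by rewrite mdegD -[X in (X < _)%N]add0n ltn_add2r lt0n mdeg_eq0.
by rewrite IH ?mulr0 //; move: lt2; rewrite -mE => /leq_trans; apply.
Qed.

Lemma psinv_ex u : pscoef0 u = 0 -> exists v, (1 - u) * v = 1.
Proof.
move=> u0; pose v := MPSeries (fun m =>
  pscoef (\sum_(k < (mdeg m).+1) u ^+ k) m).
have sumE d m : pscoef (\sum_(k < d) u ^+ k) m = \sum_(k < d) pscoef (u ^+ k) m.
  by elim: d => [|d IH]; rewrite ?big_ord0 /= ?if_same // !big_ord_recr /= IH.
exists v; apply: pseriesP => m.
have vE d k : (mdeg k < d)%N -> pscoef (\sum_(i < d) u ^+ i) k = pscoef v k.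
  move=> kd; rewrite /= !sumE -(subnKC kd) big_split_ord /= [X in _ + X]big1.
    by rewrite addr0.
  by move=> i _; apply: pscoef_exp_small => //; rewrite leq_addr.
have -> : pscoef ((1 - u) * v) m =
          pscoef ((1 - u) * \sum_(i < (mdeg m).+1) u ^+ i) m.
  rewrite /=; apply: eq_bigr => -[k1 k2] /= _.
  by congr (_ * _); apply/esym/(vE _ k2)/bmdeg.
have -> : (1 - u) * (\sum_(i < (mdeg m).+1) u ^+ i) = 1 - u ^+ (mdeg m).+1.
  by rewrite -opprB mulNr -subrX1 opprB.
by rewrite pscoefD /= pscoef_exp_small ?oppr0 ?addr0.
Qed.

End Ring.

Lemma psunit_ex n (F : fieldType) (f : mpseries n F) :
  pscoef0 f != 0 -> exists g, f * g = 1.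
Proof.
set c := pscoef0 f => c0.
have [w wE] : exists w : mpseries n F, pscoef0 w = c^-1.
  by exists (psconst n c^-1); rewrite /pscoef0 /= eqxx.
have w0 : pscoef0 (1 - f * w) = 0.
  by rewrite rmorphB rmorphM rmorph1 /= wE mulfV ?subrr.
have [v] := psinv_ex w0; rewrite subKr => <-.
by exists (w * v); rewrite mulrA.
Qed.

#[global] Arguments psmul : simpl never.
#[global] Arguments pscoef0 : simpl never.

Module Exports. HB.reexport. End Exports.
End PowerSeries.
Export PowerSeries.Exports.

From mathcomp Require Import all_classical all_reals all_analysis.
Import numFieldNormedType.Exports.
Local Open Scope classical_set_scope.
Local Open Scope ring_scope.

Section Chains.
Variables (T : Type) (F : set (set T)).

Definition has_chain (k : nat) : Prop :=
  exists C : 'I_k.+1 -> set T,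
    (forall i, F (C i)) /\ (forall i j : 'I_k.+1, (i < j)%N -> C i `<` C j).

(* The supremum of the lengths of the chains of members of F. It is only
   meaningful when it is finite; it is 0 by convention otherwise. *)
Definition max_chain : nat :=
  xget 0%N [set k | has_chain k /\ forall j, has_chain j -> (j <= k)%N].

End Chains.

Section Modules.
Variables (A : comNzRingType) (M : lmodType A).

Definition submodule (N : set M) : Prop :=
  N 0 /\ forall (a : A) u v, N u -> N v -> N (a *: u + v).

Definition module_length : nat := max_chain submodule.

End Modules.

Section Ideals.
Variable A : comNzRingType.
Implicit Types (I J S : set A).

Definition is_ideal I : Prop :=
  I 0 /\ forall a x y, I x -> I y -> I (a * x + y).

Definition prime_ideal I : Prop :=
  [/\ is_ideal I, ~ I 1 & forall x y, I (x * y) -> I x \/ I y].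

Definition maximal_ideal I : Prop :=
  [/\ is_ideal I, ~ I 1 & forall J, is_ideal J -> ~ J 1 -> I `<=` J -> J = I].

Definition krull_dim : nat := max_chain prime_ideal.

Definition ideal_gen S : set A := smallest is_ideal S.

Lemma ideal_gen_ideal S : is_ideal (ideal_gen S).
Proof.
split=> [I [[I0 _] _] //|a x y Sx Sy I II].
by have [[_ IM] _] := II; apply: IM; [exact: Sx|exact: Sy].
Qed.

Definition ideal_pred S : {pred A} := [pred x | x \in ideal_gen S].

Lemma ideal_predP S x : reflect (ideal_gen S x) (x \in ideal_pred S).
Proof. by rewrite inE; apply: (iffP idP); rewrite inE. Qed.

Fact ideal_pred_zmod_closed S : zmod_closed (ideal_pred S).
Proof.
have [I0 IM] := ideal_gen_ideal S; split=> [|x y]; first exact/ideal_predP.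
move=> /ideal_predP Ix /ideal_predP Iy; apply/ideal_predP.
by rewrite addrC -mulN1r; apply: IM.
Qed.
HB.instance Definition _ S :=
  GRing.isZmodClosed.Build A (ideal_pred S) (ideal_pred_zmod_closed S).

Lemma ideal_predM S a x : x \in ideal_pred S -> a * x \in ideal_pred S.
Proof.
have [I0 IM] := ideal_gen_ideal S.
by move=> /ideal_predP Ix; apply/ideal_predP; rewrite -[_ * _]addr0; apply: IM.
Qed.

(* The A-module A / (S). *)
Definition quotmod S := {ideal_quot (ideal_pred S)}.

Section QuotientModule.
Local Open Scope quotient_scope.
Variable S : set A.
HB.instance Definition _ := GRing.Zmodule.on (quotmod S).

Let pi : A -> quotmod S := \pi_{ideal_quot (ideal_pred S)}.

Let pi_surj (x : quotmod S) : exists a, x = pi a.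
Proof. by exists (repr x); rewrite /pi reprK. Qed.

Let piD : {morph pi : a b / a + b}.
Proof. exact: raddfD. Qed.

Definition quotmod_scale (a : A) (x : quotmod S) : quotmod S :=
  \pi_{ideal_quot (ideal_pred S)} (a * repr x).

Lemma quotmod_scaleE a b : quotmod_scale a (pi b) = pi (a * b).
Proof.
apply/eqP; rewrite -Quotient.idealrBE -mulrBr ideal_predM //.
by rewrite Quotient.idealrBE reprK.
Qed.

Fact quotmod_scaleA a b x :
  quotmod_scale a (quotmod_scale b x) = quotmod_scale (a * b) x.
Proof. by have [c ->] := pi_surj x; rewrite !quotmod_scaleE mulrA. Qed.
Fact quotmod_scale1 : left_id 1 quotmod_scale.
Proof. by move=> x; have [c ->] := pi_surj x; rewrite quotmod_scaleE mul1r. Qed.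
Fact quotmod_scaleDr : right_distributive quotmod_scale +%R.
Proof.
move=> a x y; have [b ->] := pi_surj x; have [c ->] := pi_surj y.
by rewrite -piD !quotmod_scaleE mulrDr piD.
Qed.
Fact quotmod_scaleDl x : {morph quotmod_scale^~ x : a b / a + b}.
Proof.
by have [c ->] := pi_surj x => a b; rewrite !quotmod_scaleE mulrDl piD.
Qed.
HB.instance Definition _ := GRing.Zmodule_isLmodule.Build A (quotmod S)
  quotmod_scaleA quotmod_scale1 quotmod_scaleDr quotmod_scaleDl.

End QuotientModule.
End Ideals.

Record localRing := LocalRing {
  local_ring :> comNzRingType;
  local_max : set local_ring;
  local_maxP : forall I, maximal_ideal I <-> I = local_max
}.
Arguments local_max : clear implicits.

Section HilbertKunz.
Variables (K : realType) (p : nat) (A : localRing).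

Definition frobenius_power (q : nat) : set A :=
  ideal_gen [set x ^+ q | x in local_max A].

(* Intended for A Noetherian of characteristic p; the value is 0 if the
   sequence diverges. *)
Definition hilbert_kunz : K :=
  limn (fun e : nat =>
    (module_length (quotmod (frobenius_power (p ^ e))))%:R
      / (p ^ (e * krull_dim A))%:R : K).

End HilbertKunz.

Section Quadric.
Import PowerSeries.
Variables (p n : nat).

Let P := mpseries n.+1 'F_p.

Definition quadric : P := \sum_(i < n.+1) psX _ i ^+ 2.

Definition quadric_ideal : {pred P} := ideal_pred [set quadric].

Fact quadric_ideal_coef0 f : f \in quadric_ideal -> pscoef0 f = 0.
Proof.
move=> /ideal_predP /(_ [set g : P | pscoef0 g = 0]); apply; split.
  split=> [|a x y x0 y0]; first exact: (rmorph0 (@pscoef0 _ _)).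
  by rewrite /mkset pscoef0D pscoef0M (x0 : _ = 0) (y0 : _ = 0) mulr0 addr0.
move=> _ ->; rewrite /quadric /= rmorph_sum big1 // => i _.
by rewrite rmorphXn /= pscoef0X expr0n.
Qed.

Fact quadric_idealr_closed : idealr_closed quadric_ideal.
Proof.
have [I0 IM] := ideal_gen_ideal [set quadric].
split=> [||a u v /ideal_predP Iu /ideal_predP Iv]; first exact/ideal_predP.
  apply/negP => /quadric_ideal_coef0; rewrite rmorph1.
  by apply/eqP/oner_neq0.
by apply/ideal_predP; apply: IM.
Qed.
HB.instance Definition _ :=
  isIdealr.Build P quadric_ideal quadric_idealr_closed.

Definition quadric_ring : comNzRingType := {ideal_quot quadric_ideal}.

Local Open Scope quotient_scope.
Let piA : P -> quadric_ring := \pi_{ideal_quot quadric_ideal}.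

Definition quadric_max : set quadric_ring :=
  [set piA f | f in [set f | pscoef0 f = 0]].

Lemma quadric_maxP I : maximal_ideal I <-> I = quadric_max.
Proof.
have pi_eq f g : piA f = piA g -> f - g \in quadric_ideal.
  by move=> e; rewrite Quotient.idealrBE; apply/eqP.
have mE f : quadric_max (piA f) -> pscoef0 f = 0.
  case=> g g0 /esym/pi_eq/quadric_ideal_coef0.
  by rewrite pscoef0B (g0 : pscoef0 g = 0) subr0.
have pi_surj x : exists f, x = piA f.
  by exists (repr x); rewrite /piA reprK.
have m_ideal : is_ideal quadric_max.
  split; first by exists 0; [exact: (rmorph0 (@pscoef0 _ _))|exact: raddf0].
  move=> a x y [f f0 <-] [g g0 <-]; have [h ->] := pi_surj a.
  exists (h * f + g); last by rewrite /piA rmorphD rmorphM.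
  by rewrite /mkset pscoef0D pscoef0M (f0 : _ = 0) (g0 : _ = 0) mulr0 addr0.
have m1 : ~ quadric_max 1.
  rewrite -[1](_ : piA 1 = 1); last exact: rmorph1.
  by move/mE/eqP; rewrite rmorph1 oner_eq0.
have sub J : is_ideal J -> ~ J 1 -> J `<=` quadric_max.
  move=> [J0 JM] J1 x; have [f ->] := pi_surj x => Jf.
  exists f => //=; apply: contrapT => /eqP /psunit_ex [g fg]; apply: J1.
  have -> : 1 = piA g * piA f + 0 :> quadric_ring.
    by rewrite addr0 -[RHS](rmorphM \pi_{ideal_quot quadric_ideal})
      mulrC fg rmorph1.
  exact: JM.
split=> [[Ii I1 Imax]|->].
  by rewrite (Imax quadric_max) //; apply: sub.
by split=> // J Ji J1 mJ; rewrite eqEsubset; split=> //; apply: sub.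
Qed.

Definition quadric_local : localRing := LocalRing quadric_maxP.

End Quadric.

(* The strict order of the zigzag poset z_1 > z_2 < z_3 > ..., where z_(i+1) is
   encoded as i : 'I_n: the elements of odd index lie below their neighbours. *)
Definition zigzag (n : nat) : rel 'I_n :=
  fun i j => odd i && ((i.+1 == j :> nat) || (j.+1 == i :> nat)).

(* The linear extensions of a poset on 'I_n are the order-preserving
   bijections onto the chain 'I_n. *)
Definition linear_extensions (n : nat) (r : rel 'I_n) : {set 'S_n} :=
  [set s : 'S_n | [forall i, forall j, r i j ==> (s i < s j)%N]].

Definition euler_number (n : nat) : nat := #|linear_extensions (@zigzag n)|.

(* Main.v *)
(* Let f be the sum of squares, q = p ^ e, and E the algebra of polynomials in
   n + 1 variables modulo the q-th powers of the variables.  The length of the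
   quotient of the ring of f by the q-th Frobenius power of its maximal ideal is
   the dimension c(q) of E / fE.

   Since f ^ q = 0 in E, the elements f ^ j * b with j < q and b in a monomial
   basis of E modulo fE span E.  For fixed b their degrees form an arithmetic
   progression of step 2 meeting two neighbouring residue classes modulo 2q exactly
   once, so c(q) is at least the number of monomials of E in these two classes.  For
   the two middle classes this number is governed by iterated moving sums of a
   square wave.  Folding the symmetries of the wave turns them into sums over the
   lattice points x_i + x_(i+1) <= (q - 1) / 2, that is, over order-preserving
   labellings of the zigzag poset, whence the term E_n / n!.

   Flatness of Frobenius, together with the filtration modulo f ^ p by p copies of the
   quotient modulo f, gives p ^ n * c(q) <= c(pq), so c(q) / q ^ n is nondecreasing; it is
   bounded by 2.

   The dimension of the ring of f is at least n because the vanishing ideals of cones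
   over linear sections of the quadric through a generic point form a chain of
   primes.  It is at most n because, by a weak form of Artin-Rees, a chain of primes
   of length d forces chains of ideals containing the k-th power of the maximal
   ideal whose length grows like k ^ d, whereas these have length at most 2 k ^ n. *)
From HB Require Import structures.
Require Import Defs.
From mathcomp Require Import all_boot all_order perm all_algebra.
From mathcomp Require Import zify ring lra.
From mathcomp Require boolp mpoly classical_sets.

Set Implicit Arguments.
Unset Strict Implicit.
Unset Printing Implicit Defensive.

Import GRing.Theory Order.TTheory Num.Theory.
Local Open Scope ring_scope.

(** * Counting *)

Section BoxSums.
Variable q : nat.

Lemma sum_ffunS (R : nmodType) k (T : finType) (G : {ffun 'I_k.+1 -> T} -> R) :
  \sum_f G f = \sum_t \sum_(f : {ffun 'I_k -> T})
     G [ffun i => if unlift ord0 i is Some j then f j else t].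
Proof.
rewrite pair_big /=.
pose h (u : T * {ffun 'I_k -> T}) : {ffun 'I_k.+1 -> T} :=
  [ffun i => if unlift ord0 i is Some j then u.2 j else u.1].
rewrite (reindex h) //=;
exists (fun f : {ffun 'I_k.+1 -> T} => (f ord0, [ffun j => f (lift ord0 j)])).
  move=> [t f] _ /=; congr (_, _); first by rewrite ffunE unlift_none.
  by apply/ffunP => j; rewrite !ffunE liftK.
move=> f _; apply/ffunP => i; rewrite ffunE /=.
by have [j ->|->] := unliftP ord0 i; rewrite ?ffunE.
Qed.

Definition weight k (f : {ffun 'I_k -> 'I_q}) : nat := \sum_i f i.

Lemma sum_weightS (R : nmodType) k (phi : nat -> R) :
  \sum_(f : {ffun 'I_k.+1 -> 'I_q}) phi (weight f) =
  \sum_(i < q) \sum_(f : {ffun 'I_k -> 'I_q}) phi (i + weight f)%N.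
Proof.
rewrite sum_ffunS; apply: eq_bigr => i _; apply: eq_bigr => f _; congr phi.
rewrite /weight big_ord_recl ffunE unlift_none; congr (_ + _)%N.
by apply: eq_bigr => j _; rewrite ffunE liftK.
Qed.

End BoxSums.

(** * Iterated moving sums of a square wave *)

Section SquareWave.
Variable m : nat.
Let q := (2 * m).+1.

Definition square_wave (x : int) : int := if (modz x (2 * q)%N < q)%R then 1 else -1.

Lemma square_waveP (x y k : int) : x = y + k * (2 * q)%N -> (0 <= y < (2 * q)%N)%R ->
  square_wave x = if (y < q)%R then 1 else -1.
Proof.
by move=> -> yq; rewrite /square_wave [y + _]addrC modzMDl modz_small.
Qed.

Lemma modz_2q_ex (x : int) : exists y k : int, x = y + k * (2 * q)%N /\
  (0 <= y < (2 * q)%N)%R.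
Proof.
exists (modz x (2 * q)%N), (divz x (2 * q)%N); rewrite addrC -divz_eq; split=> //.
by rewrite modz_ge0 //= ltz_pmod.
Qed.

Lemma square_waveDq (x : int) : square_wave (x + q%:Z) = - square_wave x.
Proof.
have [y [k [-> /andP[y0 yq]]]] := modz_2q_ex x; rewrite (square_waveP erefl) ?y0 //.
have [ltyq|leqy] := ltP y q.
  by rewrite (@square_waveP _ (y + q%:Z) k); [rewrite ifF //; lia | lia | lia].
by rewrite (@square_waveP _ (y - q%:Z) (k + 1)) ?opprK; [rewrite ifT //;
  lia | lia | lia].
Qed.

Lemma square_wave_sym (x : int) : square_wave (2 * m%:Z - x) = square_wave x.
Proof.
have [y [k [-> /andP[y0 yq]]]] := modz_2q_ex x; rewrite (square_waveP erefl) ?y0 //.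
have [ltyq|leqy] := ltP y q.
  by rewrite (@square_waveP _ (2 * m%:Z - y) (- k)); [rewrite ifT //; lia | lia | lia].
by rewrite (@square_waveP _ (2 * m%:Z - y + (2 * q)%N%:Z) (- k - 1)); [rewrite ifF //;
  lia | lia | lia].
Qed.

(** The [k]-fold moving sum of the square wave over windows of length [q]. The wave is symmetric
    about [m], and each of the [k] summands of [weight f] averages [m], so the shift [m * k.+1]
    makes the result an even function. *)
Definition wave k (x : int) : int :=
  \sum_(f : {ffun 'I_k -> 'I_q}) square_wave (m%:Z * k.+1%:Z + x - (weight f)%:Z).

Lemma wave0 x : wave 0 x = square_wave (m%:Z + x).
Proof.
rewrite /wave (eq_bigr (fun=> square_wave (m%:Z + x))) => [|f _]; last first.
  by rewrite /weight big_ord0 subr0 mulr1.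
by rewrite sumr_const card_ffun !card_ord.
Qed.

Lemma waveS k x : wave k.+1 x = \sum_(i < q) wave k (x + m%:Z - i%:Z).
Proof.
rewrite /wave (@sum_weightS q _ k (fun w => square_wave (m%:Z * k.+2%:Z + x - w%:Z))).
apply: eq_bigr => i _; apply: eq_bigr => f _; congr square_wave; lia.
Qed.

Lemma waveDq k (x : int) : wave k (x + q%:Z) = - wave k x.
Proof.
rewrite /wave -sumrN; apply: eq_bigr => f _; rewrite -square_waveDq;
  congr square_wave; lia.
Qed.

Lemma waveN k x : wave k (- x) = wave k x.
Proof.
elim: k x => [|k IH] x; first by rewrite !wave0 -square_wave_sym; congr square_wave;
  lia.
rewrite !waveS [RHS](reindex_inj rev_ord_inj) /=; apply: eq_bigr => i _.
by rewrite -IH; congr wave; have := ltn_ord i; rewrite /q; lia.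
Qed.

(** The window of [waveS] is [[j - m, j + m]]. Evenness and the sign change under a shift by [q]
    give [wave k (q - x) = - wave k x], so the top [2j] terms cancel in pairs. The remaining window
    [[j - m, m - j]] is symmetric and folds about 0. *)
Lemma wave_fold k (j : nat) : (j <= m)%N ->
  wave k.+1 j%:Z = wave k 0 + (\sum_(i < m - j) wave k i.+1%:Z) *+ 2.
Proof.
move=> jm; rewrite waveS -(big_mkord xpredT (fun i => wave k (j%:Z + m%:Z - i%:Z))).
rewrite (@big_cat_nat _ _ _ (2 * j)) //=; last by rewrite /q; lia.
have -> : \sum_(0 <= i < 2 * j) wave k (j%:Z + m%:Z - i%:Z) = 0.
  set S := \sum_(_ <= _ < _) _; suff : S = - S by lia.
  rewrite {1}/S big_mkord (reindex_inj rev_ord_inj) /= -sumrN big_mkord.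
  apply: eq_bigr => i _; rewrite -[in RHS]waveN -waveDq; congr wave.
  by have := ltn_ord i; rewrite /q; lia.
rewrite add0r -{1}[(2 * j)%N]add0n big_addn.
have -> : (q - 2 * j = (m - j) + (m - j).+1)%N by rewrite /q; lia.
rewrite big_mkord big_split_ord big_ord_recl /= addrCA; congr (_ + _).
  by congr wave; lia.
rewrite mulr2n; congr (_ + _); last first.
  by apply: eq_bigr => i _; rewrite -waveN; congr wave; rewrite /bump; lia.
rewrite (reindex_inj rev_ord_inj) /=; apply: eq_bigr => i _; congr wave.
by have := ltn_ord i; lia.
Qed.

Lemma wave_ge0 k (j : nat) : (j <= m)%N -> 0 <= wave k j%:Z.
Proof.
elim: k j => [|k IH] j jm.
  by rewrite wave0 (@square_waveP _ (m%:Z + j%:Z) 0) ?ifT // /q; lia.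
rewrite wave_fold // addr_ge0 ?IH // mulrn_wge0 // sumr_ge0 // => i _.
by apply: IH; have := ltn_ord i; lia.
Qed.

(** An index [x] stands for the integer [x + 1]: two neighbours in [[1, m]] must have sum at most
    [m], which is [(q - 1) / 2]. *)
Definition step (x y : 'I_m) : bool := (x + y + 2 <= m)%N.

Definition walks k (x : 'I_m) : nat := #|[set t : k.-tuple 'I_m | path step x t]|.

Lemma walks0 x : walks 0 x = 1%N.
Proof.
rewrite /walks (eq_card (B := predT)) ?card_tuple ?expn0 // => t.
by rewrite !inE tuple0.
Qed.

Lemma walksS k x : walks k.+1 x = \sum_(y | step x y) walks k y.
Proof.
rewrite /walks -sum1_card.
pose h (u : 'I_m * k.-tuple 'I_m) : k.+1.-tuple 'I_m := [tuple of u.1 :: u.2].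
rewrite (reindex h) /=; last first.
  exists (fun t => (thead t, [tuple of behead t])) => [[y t] _|t _].
    by congr (_, _); apply: val_inj.
  by rewrite /h /= -tuple_eta.
rewrite (eq_bigl (fun u : 'I_m * k.-tuple 'I_m =>
  step x u.1 && (u.2 \in [set t : k.-tuple 'I_m | path step u.1 t]))) => [|u].
  rewrite -(pair_big_dep (step x) (fun y t => t \in [set t : k.-tuple 'I_m | path step
    y t]) (fun _ _ => 1%N)) /=.
  by apply: eq_bigr => y _; rewrite sum1_card.
by rewrite !inE.
Qed.

(** Each fold contributes a factor 2 and a range of summation that is exactly the set of [y] with
    [step x y]; the central term [wave k 0] is nonnegative and is dropped. *)
Lemma wave_ge_walks k (x : 'I_m) : 2 ^+ k * (walks k x)%:Z <= wave k x.+1%:Z.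
Proof.
elim: k x => [|k IH] x.
  by rewrite walks0 wave0 (@square_waveP _ (m%:Z + x.+1%:Z) 0) ?ifT //;
    have := ltn_ord x; rewrite /q; lia.
have xm := ltn_ord x.
rewrite wave_fold //; apply: (@le_trans _ _ ((\sum_(i < m - x.+1) wave k i.+1%:Z) *+
  2)); last first.
  by rewrite lerDr; apply: (wave_ge0 k (leq0n m)).
rewrite exprS -mulrA mulr_natl lerMn2r /= walksS.
have le : (m - x.+1 <= m)%N by exact: leq_subr.
rewrite (big_ord_widen m (fun i => wave k i.+1%:Z) le).
rewrite (big_morph Posz PoszD (erefl 0%:Z)) mulr_sumr.
rewrite [leRHS](eq_bigl (fun i : 'I_m => step x i)) => [|i];
  first by apply: ler_sum => i _.
by rewrite /step; lia.
Qed.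

(** The two middle residue classes lead to the values at 0 and 1. Folding at 0 keeps one nonnegative
    term more than folding at 1, so one bound serves both. *)
Lemma wave_ge_walks0 k (m_gt0 : (0 < m)%N) :
  2 ^+ k * (walks k (Ordinal m_gt0))%:Z <= wave k 0 /\
  2 ^+ k * (walks k (Ordinal m_gt0))%:Z <= wave k 1.
Proof.
have w1 := wave_ge_walks k (Ordinal m_gt0); split=> //; apply: le_trans w1 _ => /=.
case: k => [|k].
  rewrite !wave0 (@square_waveP _ (m%:Z + 1) 0) ?(@square_waveP _ (m%:Z + 0) 0) ?ifT //
    /q; lia.
rewrite (wave_fold k m_gt0) (wave_fold k (leq0n m)) lerD2l lerMn2r /= subn0.
rewrite -!(big_mkord xpredT (fun i => wave k i.+1%:Z)).
rewrite [leRHS](@big_cat_nat _ _ _ (m - 1)) ?leq_subr //= lerDl.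
by rewrite big_nat sumr_ge0 // => i /andP[_ im]; apply: wave_ge0.
Qed.

(* At most one i has i + w congruent to r, and whether it lies in [0, q) is read off
   the square wave. *)
Lemma sum_residue (r w : nat) :
  (\sum_(i < q) (i + w == r %[mod 2 * q])%N%:Z) *+ 2 = 1 + square_wave (r%:Z - w%:Z).
Proof.
have [y [k [rE yq]]] := modz_2q_ex (r%:Z - w%:Z).
have iE (i : 'I_q) : (i + w == r %[mod 2 * q])%N = (i%:Z == y).
  rewrite -eqz_nat -!modz_nat (_ : r%:Z = k * (2 * q)%N%:Z + y + w%:Z); last by lia.
  rewrite PoszD eqz_modDr modzMDl !modz_small //; have := ltn_ord i; lia.
rewrite (square_waveP rE yq); under eq_bigr do rewrite iE.
have [ltyq|leqy] := ltP y q%:Z; last first.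
  by rewrite big1 // => i _; case: eqP => // iy; have := ltn_ord i; lia.
case: y yq ltyq {rE iE} => // y _ yq.
rewrite (bigD1 (Ordinal (yq : (y < q)%N))) //= eqxx big1 // => i iy.
by case: eqP => // -[] iE; case/eqP: iy; apply: val_inj.
Qed.

(** Summing out one coordinate by [sum_residue] leaves a constant 1 and a square wave for each
    choice of the other [n]. The offset [m * n.+1] is half the top degree [(q - 1) * n.+1], which is
    why the centred [wave] appears. *)
Lemma card_residue n r (j : nat) : (r = m * n.+1 + j)%N ->
  #|[set a : {ffun 'I_n.+1 -> 'I_q} | weight a == r %[mod 2 * q]]|%:Z *+ 2 =
  (q ^ n)%N%:Z + wave n j%:Z.
Proof.
move=> rE; rewrite -sum1_card (big_morph Posz PoszD (erefl 0%:Z)).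
rewrite (eq_bigl (fun a : {ffun 'I_n.+1 -> 'I_q} =>
  weight a == r %[mod 2 * q])%N) => [|a]; last by rewrite inE.
rewrite big_mkcond /= (eq_bigr (fun a : {ffun 'I_n.+1 -> 'I_q} =>
  (weight a == r %[mod 2 * q])%N%:Z)) => [|a _]; last by case: eqP.
rewrite (@sum_weightS q _ n (fun w => (w == r %[mod 2 * q])%N%:Z)) exchange_big /=.
rewrite -sumrMnl (eq_bigr (fun f : {ffun 'I_n -> 'I_q} =>
  1 + square_wave (m%:Z * n.+1%:Z + j%:Z - (weight f)%:Z))).
  rewrite big_split /= sumr_const card_ffun !card_ord; congr (_ + _).
  by rewrite natz.
by move=> f _; rewrite sum_residue rE; congr (1 + square_wave _); lia.
Qed.

Lemma card_residue_pair n r (m_gt0 : (0 < m)%N) : r = (m * n.+1)%N ->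
  (q ^ n + 2 ^ n * walks n (Ordinal m_gt0) <=
   #|[set a : {ffun 'I_n.+1 -> 'I_q} | (weight a == r %[mod 2 * q]) || (weight a ==
     r.+1 %[mod 2 * q])]|)%N.
Proof.
move=> rE; pose B j := [set a : {ffun 'I_n.+1 -> 'I_q} | weight a == (r + j)%N %[mod 2
  * q]].
have -> : [set a : {ffun 'I_n.+1 -> 'I_q} | (weight a == r %[mod 2 * q]) || (weight a
  == r.+1 %[mod 2 * q])] = B 0%N :|: B 1%N.
  by apply/setP => a; rewrite !inE addn0 addn1.
have BI : B 0%N :&: B 1%N = set0.
  apply/setP => a; rewrite !inE; apply/negP => /andP[/eqP -> ].
  have q2 : (1 < 2 * q)%N by rewrite /q; lia.
  by rewrite eqn_modDl mod0n (modn_small q2).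
have := cardsUI (B 0%N) (B 1%N); rewrite BI cards0 addn0.
have := @card_residue n (r + 0) 0 (congr1 (addn^~ 0%N) rE);
  have := @card_residue n (r + 1) 1 (congr1 (addn^~ 1%N) rE).
have [] := wave_ge_walks0 n m_gt0.
rewrite -/(B 0%N) -/(B 1%N).
have -> : 2 ^+ n * (walks n (Ordinal m_gt0))%:Z = (2 ^ n * walks n (Ordinal
  m_gt0))%N%:Z.
  by rewrite PoszM -[X in _ = X * _]natz natrX.
move: #|B 0%N :|: B 1%N| #|B 0%N| #|B 1%N| (wave n 0) (wave n 1) => c c0 c1 w0 w1.
move: (2 ^ n * walks n _)%N (q ^ n)%N => w Q; lia.
Qed.

End SquareWave.

Local Close Scope ring_scope.

(** * Labellings of the zigzag poset *)

Definition strict_zigzags n M : {set {ffun 'I_n -> 'I_M}} :=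
  [set z : {ffun 'I_n -> 'I_M} | [forall i, forall j, zigzag i j ==> (z i < z j)]].

Lemma nth_enum_ord_lt M (A : {set 'I_M.+1}) i j :
  i < j < #|A| -> nth ord0 (enum A) i < nth ord0 (enum A) j.
Proof.
move=> /andP[ij jA]; have sA : sorted ltn [seq val x | x <- enum A].
  have -> : [seq val x | x <- enum A] = [seq k <- iota 0 M.+1 | [exists x in A,
    val x == k]].
    have -> : enum A = [seq x <- enum 'I_M.+1 | x \in A] by rewrite enumT.
    rewrite -val_enum_ord [RHS]filter_map; congr (map _ _); apply: eq_filter => x;
      apply/idP/existsP => [xA|[y /andP[yA /eqP/val_inj <-]//]].
    by exists x; rewrite xA eqxx.
  by apply: sorted_filter (iota_ltn_sorted _ _); exact: ltn_trans.
have := sorted_ltn_nth ltn_trans 0 sA; move=> /(_ i j).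
rewrite !inE size_map -cardE (ltn_trans ij jA) jA => /(_ isT isT ij).
by rewrite !(nth_map ord0) -?cardE // (ltn_trans ij).
Qed.

(* A linear extension and an n-element set of values determine a labelling. *)
Lemma card_strict_zigzags n M : euler_number n * 'C(M, n) <= #|strict_zigzags n M|.
Proof.
case: M => [|M].
  case: n => [|n]; last by rewrite bin0n muln0.
  rewrite bin0 muln1 (leq_trans (max_card _)) // card_Sn fact0 card_gt0.
  by apply/set0Pn; exists [ffun i : 'I_0 => match i with Ordinal _ _ => i end];
    rewrite inE; apply/forallP => -[].
pose D := setX (linear_extensions (@zigzag n)) [set A : {set 'I_M.+1} | #|A| == n].
have -> : euler_number n * 'C(M.+1, n) = #|D|.
  by rewrite cardsX card_draws card_ord.
pose h (u : 'S_n * {set 'I_M.+1}) : {ffun 'I_n -> 'I_M.+1} :=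
  [ffun i => nth ord0 (enum u.2) (u.1 i)].
(* The set of values is recovered as the image of the labelling; the permutation then follows from
   the ranks. *)
have hA s (A : {set 'I_M.+1}) : #|A| == n -> A = [set h (s, A) i | i : 'I_n].
  move=> /eqP An; apply/setP => x; apply/idP/imsetP => [xA|[i _ ->]]; last first.
    by rewrite ffunE -mem_enum mem_nth // -cardE An.
  have ix : index x (enum A) < n by rewrite -An cardE index_mem mem_enum.
  exists (s^-1 (Ordinal ix))%g => //.
  by rewrite ffunE /= permKV /= nth_index // mem_enum.
have h_inj : {in D &, injective h}.
  move=> [s A] [s' A']; rewrite !inE /= => /andP[_ An] /andP[_ An'] hh.
  have AA' : A = A' by rewrite (hA s A An) (hA s' A' An') hh.
  rewrite -AA' in hh *; congr (_, _); apply/permP => i; apply: val_inj.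
  move/ffunP/(_ i): hh; rewrite !ffunE /= => /eqP.
  by rewrite nth_uniq ?enum_uniq -?cardE ?(eqP An) // => /eqP.
rewrite -(card_in_imset h_inj); apply: subset_leq_card;
  apply/subsetP => _ /imsetP[[s A] + ->].
rewrite !inE /= => /andP[/forallP sl /eqP An]; apply/forallP => i; apply/forallP => j.
apply/implyP => ij; rewrite !ffunE /=; apply: nth_enum_ord_lt.
by rewrite An ltn_ord andbT; move/forallP/(_ j)/implyP: (sl i); apply.
Qed.

(* Reversing the values at even positions turns order conditions into
   conditions on sums. *)
Lemma card_strict_zigzags_walks m n (m_gt0 : 0 < m) :
  #|strict_zigzags n m.-1| <= walks n (Ordinal m_gt0).
Proof.
(* Labels are at most [m - 2], so even positions are reversed by [m - 2 - z i]. This turns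
   [z_odd <= z_even] into [step], and makes the initial step from 0 automatic. *)
have val_lt (z : {ffun 'I_n -> 'I_m.-1}) (i : 'I_n) : (if odd i then (z i : nat) else m
  - 2 - z i) < m.
  by have := ltn_ord (z i); case: ifP; lia.
pose h (z : {ffun 'I_n -> 'I_m.-1}) : n.-tuple 'I_m :=
  [tuple Ordinal (val_lt z i) | i < n].
have h_inj : injective h.
  move=> z z' /(congr1 (fun t => tnth t)) hh; apply/ffunP => i; apply: val_inj.
  have := congr1 (fun u => val (u i)) hh; rewrite !tnth_mktuple /=.
  by have := ltn_ord (z i); have := ltn_ord (z' i); case: ifP; lia.
rewrite -(card_imset _ h_inj); apply: subset_leq_card;
  apply/subsetP => _ /imsetP[z + ->].
rewrite !inE => /forallP zz.
apply/(pathP (Ordinal m_gt0)) => i; rewrite size_tuple => ilt.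
have nthE k (kn : k < n) : nth (Ordinal m_gt0) (h z) k = Ordinal (val_lt z (Ordinal
  kn)).
  by rewrite -[k]/(val (Ordinal kn)) -tnth_nth tnth_mktuple.
rewrite nthE; case: i ilt => [|i] ilt /=.
  rewrite /step /=; have := ltn_ord (z (Ordinal ilt)); lia.
rewrite (nthE i (ltnW ilt)) /step /=.
have := forallP (zz (Ordinal ilt)) (Ordinal (ltnW ilt)).
have := forallP (zz (Ordinal (ltnW ilt))) (Ordinal ilt).
rewrite /zigzag /= !eqxx orbT andbT.
have := ltn_ord (z (Ordinal ilt)); have := ltn_ord (z (Ordinal (ltnW ilt))).
by case: (odd i) => /=; rewrite ?implyTb; lia.
Qed.

Local Open Scope ring_scope.

(* The notations of mpoly and classical_sets are incompatible. *)
Module QuadricAlgebra.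
Import mpoly PowerSeries boolp.

(** * Power series *)

Section Coefficients.
Variables (N : nat) (R : comNzRingType).
Implicit Types (f g : mpseries N R) (a b m : 'X_{1..N}).

Lemma pscoefN f m : pscoef (- f) m = - pscoef f m.
Proof. by []. Qed.

Lemma pscoefB f g m : pscoef (f - g) m = pscoef f m - pscoef g m.
Proof. by []. Qed.

Lemma pscoef_zero m : pscoef (0 : mpseries N R) m = 0.
Proof. by rewrite /= if_same. Qed.

Lemma pscoef_sum I (r : seq I) (Q : pred I) (F : I -> mpseries N R) m :
  pscoef (\sum_(i <- r | Q i) F i) m = \sum_(i <- r | Q i) pscoef (F i) m.
Proof. exact: (big_morph (fun f => pscoef f m) (fun f g => erefl) (pscoef_zero m)). Qed.

Lemma pscoefM f g m : pscoef (f * g) m =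
  \sum_(k : 'X_{1..N < (mdeg m).+1, (mdeg m).+1} | m == (k.1 + k.2)%MM)
    pscoef f k.1 * pscoef g k.2.
Proof. by []. Qed.

Lemma pscoef_constM (c : R) g m : pscoef (psconst N c * g) m = c * pscoef g m.
Proof.
have d0 : (mdeg (0%MM : 'X_{1..N}) < (mdeg m).+1)%N by rewrite mdeg0.
rewrite pscoefM (bigD1 (BMultinom d0, BMultinom (ltnSn (mdeg m)))) /=; last first.
  by rewrite add0m.
rewrite eqxx big1 ?addr0 // => -[k1 k2] /= /andP[/eqP mE ne].
case: eqP => [k10|]; last by rewrite mul0r.
case/negP: ne; rewrite xpair_eqE !bmeqP /= k10 eqxx /=.
by apply/eqP/esym; rewrite {1}mE k10 add0m.
Qed.

Definition psmon b : mpseries N R := MPSeries (fun m => (m == b)%:R).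

Lemma pscoef_monM b g m :
  pscoef (psmon b * g) m = if (b <= m)%MM then pscoef g (m - b)%MM else 0.
Proof.
case: ifP => [bm|/negP bm].
  have bd : (mdeg b < (mdeg m).+1)%N.
    by rewrite ltnS -(submK bm) mdegD leq_addl.
  have bd' : (mdeg (m - b) < (mdeg m).+1)%N.
    by rewrite ltnS -[X in (_ <= mdeg X)%N](submK bm) mdegD leq_addr.
  rewrite pscoefM (bigD1 (BMultinom bd, BMultinom bd')) /=; last by rewrite addmC submK.
  rewrite eqxx mul1r big1 ?addr0 // => -[k1 k2] /= /andP[/eqP mE ne].
  case: eqP => [k1b|]; last by rewrite mul0r.
  case/negP: ne; rewrite xpair_eqE !bmeqP /= k1b eqxx /=.
  by apply/eqP/esym; rewrite {1}mE k1b addmC addmK.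
rewrite pscoefM; apply: big1 => -[k1 k2] /= /eqP mE.
case: eqP => [k1b|]; last by rewrite mul0r.
by case: bm; rewrite [X in (_ <= X)%MM]mE k1b lem_addr.
Qed.

Lemma psmonM a b : psmon a * psmon b = psmon (a + b)%MM.
Proof.
apply: pseriesP => m; rewrite pscoef_monM /=.
case: ifP => [am|/negP am].
  by rewrite -[in RHS](submK am) addmC (inj_eq (@addmI _ _)).
by case: eqP => // mE; case: am; rewrite mE lem_addr.
Qed.

Lemma psmon0 : psmon 0%MM = 1.
Proof. by apply: pseriesP => m /=; case: eqP. Qed.

Lemma psX_mon i : psX R i = psmon U_(i)%MM.
Proof. by []. Qed.

Lemma psmonX a k : psmon a ^+ k = psmon (a *+ k)%MM.
Proof.
elim: k => [|k IH]; first by rewrite expr0 mulm0n psmon0.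
by rewrite exprS IH psmonM mulmS.
Qed.

End Coefficients.

(** * Artin-Rees *)

Section Order.
Variables (N : nat) (R : comNzRingType).
Implicit Types (f g : mpseries N R) (m : 'X_{1..N}).

Definition ord_ge s f := forall m, (mdeg m < s)%N -> pscoef f m = 0.

Lemma ord_ge_zero s : ord_ge s 0.
Proof. by move=> m _; exact: pscoef_zero. Qed.

Lemma ord_geD s f g : ord_ge s f -> ord_ge s g -> ord_ge s (f + g).
Proof. by move=> hf hg m ms; rewrite pscoefD hf ?hg ?addr0. Qed.

Lemma ord_geM s t f g : ord_ge s f -> ord_ge t g -> ord_ge (s + t) (f * g).
Proof.
move=> hf hg m mst; rewrite pscoefM big1 // => -[k1 k2] /= /eqP mE.
have [k1s|sk1] := ltnP (mdeg k1) s; first by rewrite hf // mul0r.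
rewrite [X in _ * X]hg ?mulr0 //.
move: mst; rewrite {1}mE mdegD => lt.
by rewrite -(ltn_add2l s) (leq_ltn_trans _ lt) // leq_add2r.
Qed.

Lemma ord_ge_le s t f : (s <= t)%N -> ord_ge t f -> ord_ge s f.
Proof. by move=> st hf m ms; apply: hf; apply: leq_trans st. Qed.

Lemma ord_geMl s f g : ord_ge s g -> ord_ge s (f * g).
Proof. by move=> hg; rewrite -[s]add0n; apply: ord_geM. Qed.

Lemma ord_geMr s f g : ord_ge s f -> ord_ge s (f * g).
Proof. by rewrite mulrC; apply: ord_geMl. Qed.

Lemma ord_ge_sum s I (r : seq I) (Q : pred I) (F : I -> mpseries N R) :
  (forall i, Q i -> ord_ge s (F i)) -> ord_ge s (\sum_(i <- r | Q i) F i).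
Proof.
move=> h; apply: big_ind => //; [exact: ord_ge_zero | exact: ord_geD].
Qed.

End Order.

(* Dickson's lemma, as a bound on the degrees of the minimal elements. *)
Lemma dickson N (E : 'X_{1..N} -> Prop) :
  exists s, forall m, E m -> exists2 m', E m' & (m' <= m)%MM /\ (mdeg m' <= s)%N.
Proof.
(* Induction on the number of coordinates that may vary on [E]; those in [C] are constant on [E]. *)
suff: forall c (C : {set 'I_N}) (E : 'X_{1..N} -> Prop),
    (#|~: C| <= c)%N -> (forall a b i, i \in C -> E a -> E b -> a i = b i) ->
    exists s, forall m, E m ->
      exists2 m', E m' & (m' <= m)%MM /\ (mdeg m' <= s)%N.
  by move=> /(_ #|~: set0| set0 E); apply=> // a b i; rewrite inE.
elim=> [|c IH] C {}E Cc fixC.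
  have allC i : i \in C.
    by move: Cc; rewrite leqn0 cards_eq0 => /eqP/setP/(_ i); rewrite !inE => /negbFE.
  have [[e Ee]|nE] := pselect (exists e, E e); last first.
    by exists 0%N => m Em; case: nE; exists m.
  exists (mdeg e) => m Em; exists m => //; split; first exact: lepm_refl.
  by rewrite (_ : m = e) //; apply/mnmP => i; apply: fixC (allC i) _ _.
have [[e Ee]|nE] := pselect (exists e, E e); last first.
  by exists 0%N => m Em; case: nE; exists m.
(* An element not above [e] is smaller than [e] in some coordinate [i]. It lies in one of finitely
   many slices [m i = v], each with one more constant coordinate. *)
have slice (iv : 'I_N * 'I_(mdeg e).+1) : exists s, forall m,
  E m -> (m iv.1 < e iv.1)%N -> 
    m iv.1 = iv.2 -> exists2 m', E m' & (m' <= m)%MM /\ (mdeg m' <= s)%N.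
  case: iv => i v /=; have [iC|iC] := boolP (i \in C).
    by exists 0%N => m Em; rewrite (fixC m e i) // ltnn.
  have [|a b j|s hs] := IH (i |: C) (fun m => E m /\ m i = v).
  - have -> : ~: (i |: C) = (~: C) :\ i.
      by apply/setP => j; rewrite !inE negb_or.
    by move: Cc; rewrite (cardsD1 i (~: C)) inE iC.
  - by rewrite !inE => /orP[/eqP -> [_ ->] [_ ->] //|jC [Ea _] [Eb _]]; apply: fixC.
  by exists s => m Em _ mi; have [m' [Em' _] hm'] := hs m (conj Em mi); exists m'.
have [s hs] := choice slice.
exists (maxn (mdeg e) (\max_iv s iv)) => m Em.
have [em|/negP em] := boolP (e <= m)%MM; first by exists e => //; rewrite leq_maxl.
have [i mi] : exists i, (m i < e i)%N.
  apply: contrapT => nex; case: em; apply/mnm_lepP => i.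
  by rewrite leqNgt; apply/negP => lt; case: nex; exists i.
have mie : (m i < (mdeg e).+1)%N.
  by rewrite ltnS (leq_trans (ltnW mi)) // mdegE (bigD1 i) //= leq_addr.
have [m' Em' [m'm m's]] := hs (i, Ordinal mie) m Em mi erefl.
exists m' => //; split=> //; rewrite (leq_trans m's) // (leq_trans _ (leq_maxr _ _)) //.
exact: (leq_bigmax (i, Ordinal mie)).
Qed.

(** * Standard bases and division with control of orders *)

Section LeadingMonomials.
Variables (N : nat) (F : fieldType).
Implicit Types (f g : mpseries N F) (m : 'X_{1..N}).

(* The lowest monomial for the degree-compatible order of mpoly. *)
Definition low_mon f m :=
  pscoef f m <> 0 /\ forall m', (m' < m)%O -> pscoef f m' = 0.

Lemma low_mon_ex f m : pscoef f m <> 0 -> exists m', low_mon f m'.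
Proof.
elim/(well_founded_ind (@ltom_wf N)): m => m IH fm.
have [[m' lt fm']|nex] := pselect (exists2 m', (m' < m)%O & pscoef f m' <> 0).
  exact: IH fm'.
exists m; split=> // m' lt; apply: contrapT => fm'.
by apply: nex; exists m'.
Qed.

Lemma low_mon_sub_ord f g m b c : ord_ge (mdeg m) f -> low_mon f m ->
    low_mon g b -> (b <= m)%MM -> c = pscoef f m / pscoef g b ->
  let f' := f - psconst N c * psmon F (m - b) * g in
  forall m', (m' <= m)%O -> pscoef f' m' = 0.
Proof.
move=> fo [fm fl] [gb gl] bm cE f' m'.
rewrite le_eqVlt pscoefB -mulrA pscoef_constM pscoef_monM => /predU1P[->|lt].
  have -> : (m - b <= m)%MM by rewrite -{2}(submK bm) lem_addr.
  have -> : (m - (m - b) = b)%MM by rewrite submBA // addmC addmK.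
  by rewrite cE divfK ?subrr //; apply/eqP.
rewrite (fl m') // sub0r; case: ifP => [mb|_]; last by rewrite mulr0 oppr0.
rewrite gl ?mulr0 ?oppr0 // -(ltmc_add2l _ _ (m - b)%MM) submK //.
by rewrite addmC submK.
Qed.

(** Dickson's lemma is applied to the lowest monomials of [L]. For each exponent [b] of degree at
    most [s], [G b] is an element of [L] with lowest monomial [b], or 0 if there is none. *)
Lemma standard_basis (L : mpseries N F -> Prop) : is_ideal L ->
  exists s, exists2 G : 'X_{1..N < s.+1} -> mpseries N F, (forall b, L (G b)) &
    forall f m, L f -> low_mon f m ->
      exists b : 'X_{1..N < s.+1}, low_mon (G b) b /\ (b <= m)%MM.
Proof.
move=> [L0 _]; have [s hs] := dickson (fun m => exists2 f, L f & low_mon f m).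
have G_ex (b : 'X_{1..N < s.+1}) : exists g,
    L g /\ forall f, L f -> low_mon f b -> low_mon g b.
  have [[f Lf fb]|nex] := pselect (exists2 f, L f & low_mon f b).
    by exists f.
  by exists 0; split=> // f Lf fb; case: nex; exists f.
have [G hG] := choice G_ex; exists s, G => [b|f m Lf fm]; first by have [] := hG b.
have [|m' [g Lg gm'] [m'm m's]] := hs m; first by exists f.
pose b := BMultinom (m's : (mdeg m' < s.+1)%N).
by exists b; split=> //; exact: (hG b).2 Lg gm'.
Qed.

Section Division.
Variables (L : mpseries N F -> Prop) (s : nat) (G : 'X_{1..N < s.+1} -> mpseries N F).
Hypotheses (L_ideal : is_ideal L) (LG : forall b, L (G b)).
Hypothesis (G_low : forall f m, L f -> low_mon f m ->
  exists b : 'X_{1..N < s.+1}, low_mon (G b) b /\ (b <= m)%MM).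

Lemma idealB f g : L f -> L g -> L (f - g).
Proof.
by case: L_ideal => _ LM Lf Lg; rewrite addrC -mulN1r; apply: LM.
Qed.

Lemma idealMl f g : L g -> L (f * g).
Proof.
by case: L_ideal => L0 LM Lg; rewrite -[f * g]addr0; apply: LM.
Qed.

Lemma ideal_sum I (r : seq I) (E : I -> mpseries N F) :
  (forall i, L (E i)) -> L (\sum_(i <- r) E i).
Proof.
case: L_ideal => L0 LM LE; apply: big_ind => // f g Lf Lg.
by rewrite -[f]mul1r; apply: LM.
Qed.

(** Lowest monomials of degree [n] are cancelled one after another. A monomial [m] is cancelled by
    [m - b] times [G b] with [mdeg b <= s], so the multipliers have order at least [n - s]. *)
Lemma division_step n f : L f -> ord_ge n f ->
  exists a : 'X_{1..N < s.+1} -> mpseries N F, (forall b,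
    ord_ge (n - s) (a b)) /\ ord_ge n.+1 (f - \sum_b a b * G b).
Proof.
move=> Lf fn; have [[m fm]|f0] := pselect (exists m, low_mon f m); last first.
  exists (fun=> 0); split=> [b|m _]; first exact: ord_ge_zero.
  rewrite big1 ?subr0 => [|b _]; last by rewrite mul0r.
  by apply: contrapT => /low_mon_ex.
(* Termination: the lowest monomial rises at each cancellation, and only finitely many monomials
   have degree at most [n]. *)
have [k mk] : exists k, (#|[set v : 'X_{1..N < n.+1} | (m <= v)%O]| < k)%N.
  by exists #|[set v : 'X_{1..N < n.+1} | (m <= v)%O]|.+1.
elim: k f m Lf fn fm mk => // k IH f m Lf fn fm; rewrite ltnS => mk.
have [nm|mn] := ltnP n (mdeg m).
  exists (fun=> 0); split=> [b|m' m'n]; first exact: ord_ge_zero.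
  rewrite big1 ?subr0 => [|b _]; last by rewrite mul0r.
  by apply: fm.2; apply: lt_mdeg_ltmc; apply: leq_trans nm.
have [b [Gb bm]] := G_low Lf fm.
have mnE : mdeg m = n.
  by apply/eqP; rewrite eqn_leq mn leqNgt; apply/negP => /fn /fm.1.
pose u := psconst N (pscoef f m / pscoef (G b) b) * psmon F (m - b).
have := @low_mon_sub_ord f (G b) m b _ _ fm Gb bm erefl; rewrite mnE => /(_ fn).
set f' := f - _ => /= f'm.
have f'n : ord_ge n f'.
  move=> m' m'n; apply: f'm; apply: ltW; apply: lt_mdeg_ltmc; by rewrite mnE.
have Lf' : L f' by apply: idealB => //; apply: idealMl.
have uo : ord_ge (n - s) u.
  apply: ord_geMl => m' m's /=; case: eqP => // m'E; move: m's; rewrite m'E ltnNge.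
  case/negP; rewrite leq_subLR -mnE -{1}(submK bm) mdegD addnC leq_add2r.
  by rewrite -ltnS bmdeg.
have [a [ao af]] : exists a : 'X_{1..N < s.+1} -> mpseries N F,
    (forall b, ord_ge (n - s) (a b)) /\ ord_ge n.+1 (f' - \sum_b a b * G b).
  have [[m1 f'm1]|f'0] := pselect (exists m, low_mon f' m); last first.
    exists (fun=> 0); split=> [b'|m' _]; first exact: ord_ge_zero.
    rewrite big1 ?subr0 => [|b' _]; last by rewrite mul0r.
    by apply: contrapT => /low_mon_ex.
  have mm1 : (m < m1)%O by rewrite ltNge; apply/negP => /f'm /f'm1.1.
  apply: (IH _ m1) => //; apply: leq_trans mk; apply: proper_card.
  apply/properP; split.
    by apply/subsetP => v; rewrite !inE => /(le_trans (ltW mm1)).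
  have mb : (mdeg m < n.+1)%N by rewrite mnE.
  by exists (BMultinom mb); rewrite !inE ?lexx //= -ltNge.
exists (fun b' => a b' + (if b' == b then u else 0)); split=> [b'|].
  by apply: ord_geD => //; case: ifP => // _; exact: ord_ge_zero.
rewrite (_ : f - _ = f' - \sum_b a b * G b) //.
rewrite /f' -addrA -opprD; congr (_ - _).
under eq_bigr do rewrite mulrDl.
rewrite big_split /= addrC; congr (_ + _).
rewrite (bigD1 b) //= eqxx big1 ?addr0 // => b' /negPf ->.
by rewrite mul0r.
Qed.

Lemma division n f : L f -> ord_ge n f ->
  exists2 a : 'X_{1..N < s.+1} -> mpseries N F, (forall b, ord_ge (n - s) (a b)) &
    f = \sum_b a b * G b.
Proof.
move=> Lf fn.
have step (u : nat * mpseries N F) : exists a : 'X_{1..N < s.+1} -> mpseries N F,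
    L u.2 -> ord_ge u.1 u.2 -> (forall b, ord_ge (u.1 - s) (a b)) /\
      ord_ge u.1.+1 (u.2 - \sum_b a b * G b).
  have [[Lu un]|nh] := pselect (L u.2 /\ ord_ge u.1 u.2); last first.
    by exists (fun=> 0) => Lu un; case: nh.
  by have [a ha] := division_step Lu un; exists a.
have [A hA] := choice step.
(* The remainder after [k] division steps, of order at least [n + k]. *)
pose r := fix r k := if k is k'.+1 then
  r k' - \sum_b A ((n + k')%N, r k') b * G b else f.
have hr k : L (r k) /\ ord_ge (n + k) (r k).
  elim: k => [|k [Lr rn]]; first by rewrite addn0.
  have [_] := hA ((n + k)%N, r k) Lr rn; rewrite addnS; split=> //=.
  by apply: idealB => //; apply: ideal_sum => i; apply: idealMl.
pose B k := A ((n + k)%N, r k).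
have hB k b : ord_ge (n + k - s) (B k b) by have [Lr rn] := hr k;
  exact: (hA (_, _) Lr rn).1.
(* The infinite sum of the corrections [B k b]: those with [k > mdeg m + s] have order above
   [mdeg m] and do not reach the coefficient at [m]. *)
pose a b := MPSeries (fun m => \sum_(k < (mdeg m + s).+1) pscoef (B k b) m).
have aE K b m : (mdeg m + s < K)%N -> pscoef (a b) m = pscoef (\sum_(k < K) B k b) m.
  move=> mK; rewrite pscoef_sum /= -(subnKC mK) big_split_ord /= [X in _ + X]big1
    ?addr0 //.
  move=> i _; apply: hB => /=; lia.
exists a => [b m mn|]; first by rewrite /= big1 // => k _; apply: hB;
  rewrite (leq_trans mn) // leq_sub2r // leq_addr.
have rE K : r K = f - \sum_b (\sum_(k < K) B k b) * G b.
  elim: K => [|K IH] /=.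
    by rewrite big1 ?subr0 // => b _; rewrite big_ord0 mul0r.
  rewrite [X in X - _]IH -addrA -opprD -big_split; congr (_ - _).
  apply: eq_bigr => b _ /=.
  by rewrite big_ord_recr /= mulrDl.
apply: pseriesP => m; apply/eqP; rewrite -subr_eq0 -pscoefB; apply/eqP.
pose K := (mdeg m + s).+1.
rewrite (_ : f - _ = r K - \sum_b (a b - \sum_(k < K) B k b) * G b).
  rewrite pscoefB (hr K).2; last by rewrite addnC ltn_addr // ltnS leq_addr.
  rewrite (ord_ge_sum (s := (mdeg m).+1)) ?subr0 // => b _; apply: ord_geMr => m' m'm.
  by rewrite pscoefB (@aE K) ?subrr // ltnS leq_add2r.
rewrite rE; under [X in _ = _ - X]eq_bigr do rewrite mulrBl.
by rewrite sumrB opprB addrA subrK.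
Qed.

End Division.

(* A weak Artin-Rees lemma for multiplication by x on the quotient by J. *)
Lemma colon_ord_bound (J : mpseries N F -> Prop) x : prime_ideal J -> ~ J x ->
  exists s, forall n a j, J j -> ord_ge n (x * a - j) ->
    exists2 j', J j' & ord_ge (n - s) (a - j').
Proof.
move=> [[J0 JM] J1 JP] Jx.
(* Division is carried out in the ideal [J + (x)]. Expanding [x * a - j] in its standard basis and
   collecting the multiples of [x] gives the correction to [a]; primality of [J] removes the factor
   [x]. *)
pose L f := exists j b, J j /\ f = j + x * b.
have L_ideal : is_ideal L.
  split=> [|a f g [jf [bf [Jf ->]]] [jg [bg [Jg ->]]]].
    by exists 0, 0; rewrite mulr0 addr0.
  exists (a * jf + jg), (a * bf + bg); split; first exact: JM.
  by rewrite !mulrDr mulrCA addrACA.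
have [s [G LG G_low]] := standard_basis L_ideal.
have [jG hjG] := choice LG; have {hjG}[bG hG] := choice hjG.
exists s => n a j Jj xaj.
have Lxaj : L (x * a - j).
  exists (- j), a; split; last by rewrite addrC.
  by rewrite -mulN1r -[_ * _]addr0; apply: JM.
have [c co cE] := division L_ideal LG G_low Lxaj xaj.
exists (a - \sum_b c b * bG b); last first.
  rewrite subKr; apply: ord_ge_sum => b _; exact/ord_geMr/co.
have xE : x * (a - \sum_b c b * bG b) = j + \sum_b c b * jG b.
  rewrite mulrBr -[x * a](subrK j) cE mulr_sumr.
  rewrite (eq_bigr (fun b => c b * jG b + x * (c b * bG b))) => [|b _].
    by rewrite big_split /= addrAC addrK addrC.
  by rewrite (hG b).2 mulrDr mulrCA.
have Jx' : J (x * (a - \sum_b c b * bG b)).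
  rewrite xE -[j]mul1r; apply: (JM) => //; apply: big_ind => // [f g Jf Jg|b _].
    by rewrite -[f]mul1r; apply: JM.
  by rewrite -[_ * _]addr0; apply: JM J0; case: (hG b).
by have [] := JP _ _ Jx'.
Qed.
End LeadingMonomials.

(** * Truncation to a box *)

(** A subspace inside [Q] of maximal dimension is all of [Q], since adjoining a missing vector would
    enlarge it. *)
Lemma vspace_of_pred (F : fieldType) (V : vectType F) (Q : V -> Prop) :
  Q 0 -> (forall c u v, Q u -> Q v -> Q (c *: u + v)) ->
  exists U : {vspace V}, forall u, u \in U <-> Q u.
Proof.
move=> Q0 QD.
pose D d := `[< exists2 U : {vspace V}, \dim U = d & forall u, u \in U -> Q u >].
have D_ex : exists d, D d.
  exists 0%N; apply/asboolP; exists 0%VS; first exact: dimv0.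
  by move=> u; rewrite memv0 => /eqP ->.
have D_ub d : D d -> (d <= \dim {:V})%N.
  by move=> /asboolP[U <- _]; apply/dimvS/subvf.
case: (ex_maxnP D_ex D_ub) => d /asboolP[U Ud UQ] d_max; exists U => u.
split=> [/UQ //|Qu]; have UuQ v : v \in (U + <[u]>)%VS -> Q v.
  move=> /memv_addP[w wU [_ /vlineP[c ->] ->]]; rewrite addrC.
  by apply: QD => //; apply: UQ.
have /d_max : D (\dim (U + <[u]>)) by apply/asboolP; exists (U + <[u]>)%VS.
rewrite -Ud => le; have /eqP -> : U == (U + <[u]>)%VS by rewrite eqEdim addvSl.
exact: (subvP (addvSr _ _)) (memv_line u).
Qed.

Section Truncation.
Variables (F : fieldType) (N q : nat).
Local Notation P := (mpseries N F).
Local Notation I := {ffun 'I_N -> 'I_q}.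
Local Notation E := {ffun I -> F^o}.
Implicit Types (f g h : P) (u v : E) (a b : I) (U : {vspace E}).

Definition mon a : 'X_{1..N} := [multinom (a i : nat) | i < N].

Lemma monE a i : mon a i = a i. Proof. by rewrite mnmE. Qed.

Lemma mon_inj : injective mon.
Proof.
move=> a b /mnmP ab; apply/ffunP => i; apply/val_inj.
by have := ab i; rewrite !monE.
Qed.

Lemma mon_lem m a : (m <= mon a)%MM -> exists b, m = mon b.
Proof.
move=> /mnm_lepP ma; have mq i : (m i < q)%N.
  by apply: leq_ltn_trans (ma i) _; rewrite monE.
by exists [ffun i => Ordinal (mq i)]; apply/mnmP => i; rewrite monE ffunE.
Qed.

(** The quotient map modulo the [q]-th powers of the variables, whose target is encoded as the
    coefficient functions on the box of exponents below [q]. *)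
Definition tr g : E := [ffun a => pscoef g (mon a)].

Lemma trE g a : tr g a = pscoef g (mon a). Proof. by rewrite ffunE. Qed.

Fact tr_is_zmod_morphism : zmod_morphism tr.
Proof. by move=> f g; apply/ffunP => a; rewrite !ffunE. Qed.
HB.instance Definition _ := GRing.isZmodMorphism.Build P E tr tr_is_zmod_morphism.

Lemma trB f g : tr (f - g) = tr f - tr g. Proof. exact: raddfB. Qed.
Lemma trD f g : tr (f + g) = tr f + tr g. Proof. exact: raddfD. Qed.
Lemma tr0 : tr 0 = 0. Proof. exact: raddf0. Qed.

Lemma tr_constM c g : tr (psconst N c * g) = c *: tr g.
Proof. by apply/ffunP => a; rewrite !ffunE pscoef_constM. Qed.

Definition untr u : P :=
  MPSeries (fun m => if [pick a | mon a == m] is Some a then u a else 0).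

Lemma untrK : cancel untr tr.
Proof.
move=> u; apply/ffunP => a; rewrite ffunE /=.
case: pickP => [b /eqP/mon_inj -> //|/(_ a)].
by rewrite eqxx.
Qed.

(** The box is closed under divisors, so coefficients of a product in the box involve only
    coefficients of [g] in the box. *)
Lemma tr_mul_eq0 f g : tr g = 0 -> tr (f * g) = 0.
Proof.
move=> g0; apply/ffunP => a; rewrite !ffunE pscoefM big1 // => -[k1 k2] /= /eqP aE.
have [b bE] : exists b, bmnm k2 = mon b.
  by apply: (@mon_lem _ a); rewrite [X in (_ <= X)%MM]aE lem_addl.
by move/ffunP/(_ b): g0; rewrite !ffunE -bE => ->; rewrite mulr0.
Qed.

Lemma tr_mulr f g g' : tr g = tr g' -> tr (f * g) = tr (f * g').
Proof.
move=> gg'; apply/eqP; rewrite -subr_eq0 -trB -mulrBr tr_mul_eq0 //.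
by rewrite trB gg' subrr.
Qed.

Definition act_fun h u := tr (h * untr u).

Fact act_fun_is_linear h : linear (act_fun h).
Proof.
move=> c u v; rewrite /act_fun -tr_constM -trD mulrCA -mulrDr.
by apply: tr_mulr; rewrite trD /= tr_constM !untrK.
Qed.
HB.instance Definition _ h :=
  GRing.isLinear.Build F E E *:%R (act_fun h) (act_fun_is_linear h).

Definition act h : 'End(E) := linfun (act_fun h).

Lemma act_tr h g : act h (tr g) = tr (h * g).
Proof. by rewrite lfunE; apply: tr_mulr; rewrite untrK. Qed.

Lemma actM f g u : act (f * g) u = act f (act g u).
Proof. by rewrite -[u]untrK !act_tr mulrA. Qed.

Definition delta a : E := tr (psmon F (mon a)).

Lemma deltaE a b : delta a b = (b == a)%:R.
Proof. by rewrite trE /= (inj_eq mon_inj). Qed.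

Lemma delta_sum u : u = \sum_a u a *: delta a.
Proof.
apply/ffunP => b; rewrite sum_ffunE (bigD1 b) //= ffunE deltaE eqxx.
rewrite [_ *: _]mulr1 big1 ?addr0 // => a /negPf ab.
by rewrite ffunE deltaE eq_sym ab [_ *: _]mulr0.
Qed.

Lemma mem_delta U u : (forall a, u a != 0 -> delta a \in U) -> u \in U.
Proof.
move=> h; rewrite [u]delta_sum; apply: memv_suml => a _.
by have [->|/h/memvZ//] := eqVneq (u a) 0; rewrite scale0r mem0v.
Qed.

Definition stable U := forall h u, u \in U -> act h u \in U.

Lemma stable_limg f : stable (limg (act f)).
Proof.
move=> h _ /memv_imgP[u _ ->]; rewrite -actM mulrC actM.
exact: memv_img (memvf _).
Qed.

(** A monomial of greatest degree among those outside [U] works: multiplication by [h] sends it to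
    its multiple by the constant term of [h] plus monomials of higher degree, which lie in [U]. *)
Lemma stable_extend U : stable U -> U != fullv ->
  exists a, delta a \notin U /\ stable (U + <[delta a]>)%VS.
Proof.
move=> Ust Uf.
have [a0 a0U] : exists a, delta a \notin U.
  apply: contrapT => nex; case/negP: Uf; rewrite eqEsubv subvf /=.
  apply/subvP => u _; apply: mem_delta => a _.
  by apply: contrapT => /negP aU; apply: nex; exists a.
have [a aU a_max] : exists2 a, delta a \notin U &
    forall b, delta b \notin U -> (mdeg (mon b) <= mdeg (mon a))%N.
  exists [arg max_(a > a0 | delta a \notin U) mdeg (mon a)]%N; case: arg_maxnP => //.
exists a; split=> // h _ /memv_addP[u uU [_ /vlineP[c ->] ->]].
rewrite linearD linearZ /= memvD //; first exact/(subvP (addvSl _ _))/Ust.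
apply: memvZ; rewrite act_tr mulrC.
rewrite -[tr _](subrK (pscoef0 h *: delta a)) memvD //; last first.
  by apply/memvZ/(subvP (addvSr _ _))/memv_line.
apply/(subvP (addvSl _ _))/mem_delta => b; rewrite !ffunE pscoef_monM /=.
rewrite (inj_eq mon_inj) => bn0; apply: contrapT => /negP /a_max.
have [ba|ba] := eqVneq b a.
  case/eqP: bn0; rewrite ba lepm_refl eqxx [_ *: _]mulr1.
  by rewrite /pscoef0 (_ : (_ - _)%MM = 0%MM) ?subrr //; apply/mnmP => i;
    rewrite !mnmE subnn.
move: bn0; rewrite (negPf ba) [_ *: _]mulr0 subr0.
case: ifP => [ab _|]; last by rewrite eqxx.
rewrite -(submK ab) mdegD -[X in (_ <= X)%N]add0n leq_add2r leqn0 mdeg_eq0 => /eqP ab0.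
by case/eqP: ba; apply: mon_inj; rewrite -(submK ab) ab0 add0m.
Qed.

(* The flag realizes the length; its steps are spanned by classes of monomials. *)
Lemma stable_flag U : stable U -> exists (s : seq I) (C : nat -> {vspace E}),
  [/\ (size s + \dim U)%N = \dim {:E},
      (U + <<[seq delta a | a <- s]>>)%VS = fullv, C 0%N = U &
      forall i, (i <= size s)%N -> stable (C i) /\ (\dim (C i) = \dim U + i)%N] /\
      forall i, (i < size s)%N -> (C i <= C i.+1)%VS.
Proof.
have [c] := ubnP (\dim {:E} - \dim U); elim: c U => // c IH U cU Ust.
have [->|Uf] := eqVneq U fullv.
  exists [::], (fun=> fullv); split=> //; split=> //=.
    by rewrite span_nil addv0.
  by move=> [|i] // _; rewrite addn0; split=> // h u _; apply: memvf.
have [a [aU Ust']] := stable_extend Ust Uf; set U' := (U + _)%VS in Ust'.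
have dU' : \dim U' = (\dim U).+1.
  have a0 : delta a != 0 by apply: contraNneq aU => ->; exact: mem0v.
  rewrite dimv_disjoint_sum ?dim_vline ?a0 ?addn1 //.
  apply/eqP; rewrite -subv0; apply/subvP => v; rewrite memv_cap memv0.
  case/andP => vU /vlineP[k vE]; apply: contraNT aU => v0.
  have k0 : k != 0 by apply: contraNneq v0 => k0; rewrite vE k0 scale0r.
  by rewrite -[delta a](scalerK k0) -vE memvZ.
have lt : (\dim U < \dim {:E})%N by rewrite -dU' dimvS ?subvf.
have [|s [C [[sz sp C0 Cst] Cinc]]] := IH U' _ Ust'; first by lia.
exists (a :: s), (fun i => if i is j.+1 then C j else U).
split; [split=> //=|].
- by rewrite -sz dU' addSnnS.
- by rewrite span_cons addvA.
- case=> [|i] ilt; first by rewrite addn0.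
  by have [h1 ->] := Cst i ilt; split=> //; rewrite dU' addSnnS.
case=> [|i] ilt; last exact: Cinc.
by rewrite C0 addvSl.
Qed.

(** Every member of the chain contains the kernel of [tr], hence is the preimage of a subspace of
    [E], and strict inclusions raise the dimension. *)
Lemma chain_codim U (C : nat -> P -> Prop) l :
  (forall i, (i <= l)%N -> is_ideal (C i)) ->
  (forall g, tr g \in U -> C 0%N g) ->
  (forall i, (i < l)%N -> (forall g, C i g -> C i.+1 g) /\ exists2 g,
    C i.+1 g & ~ C i g) ->
  (l <= \dim {:E} - \dim U)%N.
Proof.
move=> Cid UC Cinc.
have CM i g : (i <= l)%N -> C 0%N g -> C i g.
  by elim: i => // i IH il /(IH (ltnW il)); apply: (Cinc i il).1.
have CB i f g : (i <= l)%N -> C i f -> C i g -> C i (f - g).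
  by move=> /Cid[_ CM'] Cf Cg; rewrite addrC -mulN1r; apply: CM'.
have Cuntr i g : (i <= l)%N -> C i (untr (tr g)) <-> C i g.
  move=> il; have Cd f f' : tr f = tr f' -> C i f -> C i f'.
    move=> ff' Cf; rewrite -[f'](subKr f); apply: CB => //.
    by apply/CM/UC; rewrite // trB ff' subrr mem0v.
  by split; apply: Cd; rewrite untrK.
have V_ex i : (i <= l)%N -> exists V : {vspace E}, forall g, tr g \in V <-> C i g.
  move=> il; have [[C0 CM'] Cl] := (Cid i il, fun g => Cuntr i g il).
  have [|c u v Cu Cv|V hV] := @vspace_of_pred _ E (fun u => C i (untr u)).
  - by rewrite -tr0; apply/Cl.
  - by rewrite -[u]untrK -[v]untrK -tr_constM -trD; apply/Cl/CM'.
  by exists V => g; rewrite -Cl; apply: hV.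
suff H i : (i <= l)%N -> exists2 V : {vspace E}, (\dim U + i <= \dim V)%N &
    forall g, tr g \in V <-> C i g.
  by have [V dV _] := H l (leqnn l); have := dimvS (subvf V); lia.
elim: i => [|i IH] il.
  have [V hV] := V_ex 0%N il; exists V => //; rewrite addn0; apply: dimvS.
  by apply/subvP => u; rewrite -[u]untrK => /UC/hV.
have [V dV hV] := IH (ltnW il); have [V' hV'] := V_ex _ il; exists V' => //.
rewrite addnS (leq_ltn_trans dV) //.
have [inc [g Cg nCg]] := Cinc i il.
have VV' : (V <= V')%VS by apply/subvP => u; rewrite -[u]untrK => /hV/inc/hV'.
rewrite ltn_neqAle dimvS // andbT; apply: contra_notN nCg => /eqP dVV'.
have /eqP VE : V == V' by rewrite eqEdim VV' dVV' leqnn.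
by apply/hV; rewrite VE; apply/hV'.
Qed.

End Truncation.

(** * Codimension *)

Section Codim.
Variables (F : fieldType) (N q : nat).
Local Notation P := (mpseries N F).
Local Notation I := {ffun 'I_N -> 'I_q}.
Local Notation E := {ffun I -> F^o}.
Implicit Types (f g h : P) (u v : E) (a b : I) (U : {vspace E}).

Definition codim f : nat := \dim {:E} - \dim (limg (@act F N q f)).

Lemma dim_box : \dim {:E} = (q ^ N)%N.
Proof.
rewrite dimvf (_ : dim E = #|{: I}| * dim F^o)%N // (_ : dim F^o = 1%N) //.
by rewrite muln1 card_ffun !card_ord.
Qed.

Lemma span_delta : <<[seq delta F a | a <- enum I]>>%VS = fullv.
Proof.
apply/eqP; rewrite eqEsubv subvf; apply/subvP => u _; apply: mem_delta => a _.
by apply: memv_span; apply: map_f; rewrite mem_enum.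
Qed.

Lemma free_delta (A : pred I) : free [seq delta F a | a <- enum A].
Proof.
have : free [seq delta F a | a <- enum I].
  by rewrite /free span_delta dim_box size_map -cardE card_ffun !card_ord.
have -> : enum A = [seq a <- enum I | A a] by rewrite enumT.
move=> /(filter_free [pred u : E | [exists (a | A a), u == delta F a]]).
rewrite filter_map; congr (free (map _ _)); apply: eq_filter => a /=;
  apply/existsP/idP => [[b /andP[Ab /eqP ab]]|Aa].
  have := congr1 (fun u : E => u a) ab; rewrite !deltaE eqxx.
  by case: eqP => [->|_ /eqP] //; rewrite oner_eq0.
by exists a; rewrite eqxx andbT.
Qed.

(** Multiplying the hypothesis by [f ^ k] splits the image of [f ^ k] into that of [f ^ k.+1] and
    the span of the [f ^ k * a]. *)
Lemma limg_expand f (s : seq I) k :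
  (limg (act q f) + <<[seq delta F a | a <- s]>>)%VS = fullv ->
  (limg (act q (f ^+ k)) +
    <<[seq act q (f ^+ j) (delta F a) | a <- s, j <- iota 0 k]>>)%VS = fullv.
Proof.
move=> sE; elim: k => [|k IH].
  apply/eqP; rewrite eqEsubv subvf; apply/subvP => u _.
  apply/(subvP (addvSl _ _)); rewrite -[u](@untrK F N q) -[untr u]mul1r -act_tr expr0.
  exact: memv_img (memvf _).
apply/eqP; rewrite eqEsubv subvf andTb -{1}IH subv_add; apply/andP; split; last first.
  apply: (subv_trans _ (addvSr _ _)); apply: sub_span => u.
  case/allpairsPdep => a [j [sa jk ->]].
  apply: (@allpairs_f_dep _ _ _ (fun a j => act q (f ^+ j) (delta F a))) => //.
  by move: jk; rewrite !mem_iota !add0n => /andP[_ jk]; rewrite (ltn_trans jk).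
rewrite -{1}sE limgD subv_add; apply/andP; split.
  apply: (subv_trans _ (addvSl _ _)); apply/subvP =>
    _ /memv_imgP[_ /memv_imgP[u _ ->] ->].
  by rewrite -actM -exprSr; apply: memv_img (memvf _).
apply: (subv_trans _ (addvSr _ _)); rewrite limg_span -map_comp.
apply: sub_span => _ /mapP[a sa ->]; apply: (@allpairs_f_dep _ _ _ (fun a j =>
  act q (f ^+ j) (delta F a))) => //.
by rewrite mem_iota ltnSn.
Qed.

Definition homogeneous d f := forall m, pscoef f m != 0 -> mdeg m = d.

Lemma homogeneousX d f j : homogeneous d f -> homogeneous (d * j) (f ^+ j).
Proof.
move=> fd; elim: j => [|j IH] m.
  by rewrite expr0 /=; case: (m =P 0%MM) => [->|_]; rewrite ?eqxx ?mdeg0 ?muln0.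
rewrite exprS; have [[k hk]|nk] := pselect (exists k : 'X_{1..N} * 'X_{1..N},
  m = (k.1 + k.2)%MM /\ pscoef f k.1 * pscoef (f ^+ j) k.2 != 0).
  case: hk => ->; rewrite mulf_eq0 negb_or => /andP[/fd h1 /IH h2] _.
  by rewrite mdegD h1 h2 mulnS.
rewrite pscoefM big1 ?eqxx // => -[k1 k2] /= /eqP mE.
by apply/eqP; apply: contraPT isT => k0; case: nk; exists (bmnm k1, bmnm k2).
Qed.

Lemma act_deltaE f a b : act q f (delta F a) b =
  if (mon a <= mon b)%MM then pscoef f (mon b - mon a) else 0.
Proof. by rewrite act_tr trE mulrC pscoef_monM. Qed.

Lemma act_homogeneous d f a b : homogeneous d f ->
  act q f (delta F a) b != 0 -> mdeg (mon b) = (mdeg (mon a) + d)%N.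
Proof.
move=> fd; rewrite act_deltaE; case: ifP => [ab /fd <-|]; last by rewrite eqxx.
by rewrite -mdegD addmC submK.
Qed.

Definition restr_fun (D : pred nat) u : E :=
  [ffun a => if D (mdeg (mon a)) then u a else 0].

Fact restr_is_linear D : linear (restr_fun D).
Proof.
move=> c u v; apply/ffunP => a; rewrite !ffunE; case: ifP => // _.
by rewrite scaler0 addr0.
Qed.
HB.instance Definition _ D :=
  GRing.isLinear.Build F E E *:%R (restr_fun D) (restr_is_linear D).

(** The modulus is even, so the parity of [d] decides between [r] and [r.+1]; within one class,
    [2 * j] modulo [2 * q] determines [j < q]. *)
Lemma size_progression r d : (size [seq j <- iota 0 q |
  (d + 2 * j == r %[mod 2 * q]) || (d + 2 * j == r.+1 %[mod 2 * q])] <= 1)%N.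
Proof.
set D := fun j => _ || _; set l := filter _ _.
have lu : uniq l by rewrite filter_uniq ?iota_uniq.
have lD j : j \in l -> (j < q)%N /\ D j by rewrite mem_filter mem_iota => /andP[].
have H j k : (j < k)%N -> j \in l -> k \in l -> False.
  move=> jk /lD[jq Dj] /lD[kq Dk].
  have par x y : x == y %[mod 2 * q] -> odd x = odd y.
    move=> /eqP /(congr1 (modn^~ 2)); rewrite /= !modn_dvdm ?dvdn_mulr //.
    by rewrite !modn2; case: (odd x) (odd y) => -[].
  have : d + 2 * k == d + 2 * j %[mod 2 * q].
    move: Dj Dk => /orP[] Ej /orP[] Ek; rewrite ?(eqP Ej) ?(eqP Ek) //.
      by move/par: Ej; move/par: Ek; rewrite !oddD /=;
        case: (odd r) (odd d) (odd j) (odd k) => [] [] [] [].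
    by move/par: Ej; move/par: Ek; rewrite !oddD /=;
        case: (odd r) (odd d) (odd j) (odd k) => [] [] [] [].
  rewrite eqn_mod_dvd; last by rewrite leq_add2l leq_mul2l ltnW.
  rewrite subnDl -mulnBr dvdn_pmul2l // => /dvdn_leq; rewrite subn_gt0 => /(_ jk).
  by rewrite leqNgt => /negP; apply; lia.
case: l lu lD H => [|j [|k l]] //= /andP[]; rewrite inE negb_or => /andP[jk _] _ _ H.
case: (ltngtP j k) => jk'; last by rewrite jk' eqxx in jk.
  by case: (H j k); rewrite ?inE ?eqxx ?orbT.
by case: (H k j); rewrite ?inE ?eqxx ?orbT.
Qed.

(* A residue class modulo 2q and its neighbour meet each arithmetic progression
   d, d + 2, ..., d + 2(q - 1) exactly once. *)
Lemma codim_ge f r : homogeneous 2 f -> tr q (f ^+ q) = 0 ->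
  (#|[set a : I | (mdeg (mon a) == r %[mod 2 * q]) || (mdeg (mon a) == r.+1 %[mod 2 *
    q])]|
   <= codim f)%N.
Proof.
move=> fh fq; pose D d := (d == r %[mod 2 * q]) || (d == r.+1 %[mod 2 * q]).
have [s [C [[sz sp _ _] _]]] := stable_flag (@stable_limg F N q f).
have -> : codim f = size s by rewrite /codim -sz addnK.
have := limg_expand q sp.
have -> : limg (@act F N q (f ^+ q)) = 0%VS.
  apply/eqP; rewrite -subv0; apply/subvP => _ /memv_imgP[u _ ->].
  by rewrite -[u]untrK act_tr mulrC tr_mul_eq0 // mem0v.
rewrite add0v => spE.
(* The spanning elements whose degree lies in the two classes: at most one for each [a]. *)
pose Y := [seq act q (f ^+ j) (delta F a) | a <- s,
  j <- [seq j <- iota 0 q | D (mdeg (mon a) + 2 * j)%N]].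
have Ysz : (size Y <= size s)%N.
  rewrite size_allpairs_dep sumnE big_map -[leqRHS]sum1_size.
  by apply: leq_sum => a _; apply: size_progression.
apply: leq_trans Ysz; apply: leq_trans (dim_span Y).
pose A := [set a : I | D (mdeg (mon a))].
have -> : #|A| = \dim <<[seq delta F a | a <- enum A]>>.
  by have /eqP -> := free_delta (mem A); rewrite size_map -cardE.
apply: dimvS; apply/span_subvP => _ /mapP[a aA ->].
(* Projection to the degrees in [D] fixes this monomial, and by homogeneity it fixes or kills each
   spanning element; the survivors are those in [Y]. *)
have -> : delta F a = linfun (restr_fun D) (delta F a).
  apply/ffunP => b; rewrite lfunE [RHS]ffunE !deltaE; case: ifP => //.
  have [->|//] := eqVneq b a.
  by move: aA; rewrite mem_enum inE => ->.
have : delta F a \in fullv by apply: memvf.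
rewrite -spE => /(memv_img (linfun (restr_fun D))); rewrite limg_span.
apply/subvP/span_subvP => _ /mapP[_ /allpairsPdep[b [j [sb jq ->]]] ->].
have deg_j c : act q (f ^+ j) (delta F b) c != 0 ->
  mdeg (mon c) = (mdeg (mon b) + 2 * j)%N.
  by apply: act_homogeneous; apply: homogeneousX.
have [Db|Db] := boolP (D (mdeg (mon b) + 2 * j)%N).
  have -> : linfun (restr_fun D) (act q (f ^+ j) (delta F b)) = act q (f ^+ j) (delta F
    b).
    apply/ffunP => c; rewrite lfunE [LHS]ffunE; case: ifP => // Dc.
    by apply/esym/eqP; apply: contraFT Dc => /deg_j ->.
  by apply/memv_span/allpairsPdep; exists b, j; split; rewrite // mem_filter Db.
have -> : linfun (restr_fun D) (act q (f ^+ j) (delta F b)) = 0; last exact: mem0v.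
apply/ffunP => c; rewrite lfunE [LHS]ffunE [RHS]ffunE; case: ifP => // Dc; apply/eqP;
  apply: contraNT Db => /deg_j <-.
exact: Dc.
Qed.

End Codim.

(** * Sums of squares *)

Section Frobenius.
Variables (F : fieldType) (N p q : nat) (f : mpseries N F).
Hypothesis p_gt0 : (0 < p)%N.
(** With [f_frob0], this says that [f ^ p] is [f] with all exponents multiplied by [p]. *)
Hypothesis f_frob : forall m, pscoef (f ^+ p) (m *+ p)%MM = pscoef f m.
Hypothesis f_frob0 : forall m, pscoef (f ^+ p) m != 0 -> exists k, m = (k *+ p)%MM.
Local Notation I := {ffun 'I_N -> 'I_q}.
Local Notation I' := {ffun 'I_N -> 'I_(p * q)}.
Local Notation E := {ffun I -> F^o}.
Local Notation E' := {ffun I' -> F^o}.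

Fact quo_subproof (a : I') i : (a i %/ p < q)%N.
Proof. by rewrite ltn_divLR // (leq_trans (ltn_ord _)) // mulnC. Qed.
Definition quo (a : I') : I := [ffun i => Ordinal (quo_subproof a i)].
Definition rem (a : I') : {ffun 'I_N -> 'I_p} :=
  [ffun i => Ordinal (ltn_pmod (a i) p_gt0)].

Lemma mon_quo_rem a : mon a = (mon (quo a) *+ p + mon (rem a))%MM.
Proof. by apply/mnmP => i; rewrite mnmDE mulmnE !monE !ffunE -divn_eq. Qed.

(** Replaces each variable by its [p]-th power and multiplies by the monomial [b]; the images for
    the various [b] are the [p ^ N] copies of [E] in [E']. *)
Definition spread_fun (b : {ffun 'I_N -> 'I_p}) (u : E) : E' :=
  [ffun a => if rem a == b then u (quo a) else 0].

Fact spread_is_linear b : linear (spread_fun b).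
Proof.
move=> c u v; apply/ffunP => a; rewrite !ffunE; case: ifP => // _.
by rewrite scaler0 addr0.
Qed.
HB.instance Definition _ b :=
  GRing.isLinear.Build F E E' *:%R (spread_fun b) (spread_is_linear b).

Lemma act_frob_delta a : act (p * q) (f ^+ p) (delta F a) =
  linfun (spread_fun (rem a)) (act q f (delta F (quo a))).
Proof.
apply/ffunP => b; rewrite (lfunE (spread_fun (rem a))) [RHS]ffunE !act_deltaE.
have [ab|ab] := eqVneq (rem b) (rem a).
  have -> : (mon a <= mon b)%MM = (mon (quo a) <= mon (quo b))%MM.
    by apply/mnm_lepP/mnm_lepP => h i; have := h i;
      rewrite (mon_quo_rem a) (mon_quo_rem b) ab !mnmDE !mulmnE leq_add2r leq_pmul2r.
  case: ifP => // _; rewrite -f_frob; congr pscoef; apply/mnmP => i.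
  by rewrite (mon_quo_rem a) (mon_quo_rem b) ab !(mnmBE, mnmDE, mulmnE) subnDr mulnBl.
case: ifP => // /mnm_lepP le; apply/eqP; apply: contraNT ab => /f_frob0[k kE].
apply/eqP/ffunP => i; apply: val_inj; rewrite !ffunE /= -!monE.
have -> : mon b i = (k i * p + mon a i)%N.
  by rewrite -[LHS](subnK (le i)) -mnmBE kE mulmnE.
by rewrite modnMDl.
Qed.

Lemma dim_limg_frob :
  (\dim (limg (act (p * q) (f ^+ p))) <= p ^ N * \dim (limg (act q f)))%N.
Proof.
have sub : (limg (act (p * q) (f ^+ p)) <=
    \sum_(b : {ffun 'I_N -> 'I_p}) linfun (spread_fun b) @: limg (act q f))%VS.
  rewrite -{1}span_delta limg_span -map_comp; apply/span_subvP => _ /mapP[a _ ->] /=.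
  rewrite act_frob_delta memvE; apply: (sumv_sup (rem a)) => //; rewrite -memvE.
  by apply/memv_img/memv_img/memvf.
apply: leq_trans (dimvS sub) _; apply: leq_trans (dimv_leq_sum _ _ _) _.
have -> : (p ^ N)%N = #|{ffun 'I_N -> 'I_p}| by rewrite card_ffun !card_ord.
rewrite -sum_nat_const; apply: leq_sum => b _.
by rewrite -[leqRHS](limg_ker_dim (linfun (spread_fun b))) leq_addl.
Qed.

(* [E'] modulo [f ^+ p] is a sum of [p ^ N] copies of [E] modulo [f], and it is
   filtered by [p] quotients of [E'] modulo [f]. *)
Lemma codim_frob : (p ^ N * codim q f <= p * codim (p * q) f)%N.
Proof.
have [s [C [[sz sp _ _] _]]] := stable_flag (@stable_limg F N (p * q) f).
have -> : codim (p * q) f = size s by rewrite /codim -sz addnK.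
have := dimvS (subvv (fullv : {vspace E'})).
rewrite -{2}(limg_expand p sp) => le.
have {le} le := leq_trans le (dimv_add_leqif _ _).
set Y := [seq _ | a <- s, j <- iota 0 p] in le.
have Ysz : (\dim <<Y>> <= p * size s)%N.
  by apply: leq_trans (dim_span Y) _; rewrite size_allpairs size_iota mulnC.
rewrite dim_box expnMn in le.
rewrite /codim dim_box mulnBr leq_subLR.
apply: leq_trans le _.
by rewrite leq_add // dim_limg_frob.
Qed.

End Frobenius.

Section Quadric.
Variables (F : fieldType) (n : nat).
Local Notation P := (mpseries n.+1 F).

Definition sum_squares : P := \sum_(i < n.+1) psX F i ^+ 2.

Lemma pscoef_pure_sum k m :
  pscoef (\sum_(i < n.+1) psX F i ^+ k : P) m = \sum_(i < n.+1) (m == U_(i) *+ k)%MM%:R.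
Proof. by rewrite pscoef_sum; apply: eq_bigr => i _; rewrite psX_mon psmonX. Qed.

Lemma sum_squares_homogeneous : homogeneous 2 sum_squares.
Proof.
move=> m; rewrite pscoef_pure_sum; apply: contraNeq => m2; rewrite big1 // => i _.
by case: eqP => // mE; rewrite mE mdegMn mdeg1 in m2.
Qed.

Lemma tr_mon q m : tr q (psmon F m) = 0 \/ exists2 a : {ffun 'I_n.+1 -> 'I_q},
  m = mon a & tr q (psmon F m) = delta F a.
Proof.
have [[a mE]|nex] := pselect (exists a : {ffun 'I_n.+1 -> 'I_q}, m = mon a).
  by right; exists a => //; rewrite mE.
left; apply/ffunP => a; rewrite !ffunE /=; case: eqP => // aE; case: nex.
by exists a.
Qed.

(** Modulo [f] the square of the first variable can be rewritten in the other variables, so the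
    monomials of degree at most 1 in it span. *)
Lemma codim_le q : (codim q sum_squares <= 2 * q ^ n)%N.
Proof.
pose I := {ffun 'I_n.+1 -> 'I_q}; pose A := [set a : I | (a ord0 <= 1)%N].
pose W := (limg (act q sum_squares) + <<[seq delta F a | a <- enum A]>>)%VS.
have WE (a : I) : delta F a \in W.
  have [k ak] := ubnP (a ord0); elim: k a ak => // k IH a ak.
  have [a1|a2] := leqP (a ord0) 1.
    by apply/(subvP (addvSr _ _))/memv_span/map_f; rewrite mem_enum inE.
  pose m := (mon a - U_(ord0) *+ 2)%MM.
  have le : (U_(ord0) *+ 2 <= mon a)%MM.
    apply/mnm_lepP => i; rewrite mulmnE mnm1E monE.
    by case: eqP => [<-|_]; rewrite ?mul1n ?mul0n.
  have -> : delta F a = act q sum_squares (tr q (psmon F m)) -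
      \sum_(i < n) tr q (psmon F (m + U_(lift ord0 i) *+ 2)).
    rewrite act_tr /sum_squares big_ord_recl mulrDl trD.
    have mulX i : psX F i ^+ 2 * psmon F m = psmon F (m + U_(i) *+ 2)%MM.
      by rewrite psX_mon psmonX psmonM addmC.
    rewrite mulX submK // mulr_suml (raddf_sum (@tr F n.+1 q)) /=.
    by under [X in _ + X - _]eq_bigr do rewrite mulX; rewrite addrK.
  rewrite rpredB //.
    by apply/(subvP (addvSl _ _))/memv_img/memvf.
  apply: memv_suml => i _; have [->|[b bE ->]] :=
    tr_mon q (m + U_(lift ord0 i) *+ 2)%MM.
    exact: mem0v.
  apply: IH; rewrite -monE -bE !(mnmDE, mulmnE, mnm1E, mnmBE) monE /=.
  lia.
have WT : W = fullv.
  apply/eqP; rewrite eqEsubv subvf; apply/subvP => u _; apply: mem_delta => a _.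
  exact: WE.
have le : (\dim {:{ffun I -> F^o}} <= \dim (limg (act q sum_squares)) + #|A|)%N.
  rewrite -{1}WT; apply: leq_trans (dimv_add_leqif _ _) _; rewrite leq_add2l.
  by apply: leq_trans (dim_span _) _; rewrite size_map -cardE.
rewrite /codim leq_subLR; apply: leq_trans le _; rewrite leq_add2l.
pose h (a : I) := (inord (a ord0) : 'I_2, [ffun i : 'I_n => a (lift ord0 i)]).
have h_inj : {in A &, injective h}.
  move=> a b; rewrite !inE => a1 b1 [ab0 /ffunP ab]; apply/ffunP => i.
  have [j ->|->] := unliftP ord0 i; first by have := ab j; rewrite !ffunE.
  by apply: val_inj; move: ab0 => /(congr1 val); rewrite /= !inordK.
rewrite -(card_in_imset h_inj) (leq_trans (max_card _)) //.
by rewrite card_prod card_ffun !card_ord.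
Qed.

End Quadric.

Section PrimeField.
Variables (p n : nat).
Hypothesis p_pr : prime p.
Local Notation P := (mpseries n.+1 'F_p).
Local Notation f := (sum_squares 'F_p n).

Lemma pchar_series : p \in [pchar P].
Proof.
apply/andP; split=> //; apply/eqP/pseriesP => m.
have -> : pscoef (p%:R : P) m = pscoef (1 : P) m *+ p.
  have cMn k : pscoef (k%:R : P) m = pscoef (1 : P) m *+ k.
    by elim: k => [|k IH]; rewrite ?mulr0n ?pscoef_zero // !mulrS pscoefD IH.
  exact: cMn.
by rewrite -mulr_natr -(Fp_nat_mod p_pr) modnn mulr0 pscoef_zero.
Qed.

Lemma sum_squares_frob e : f ^+ (p ^ e) = \sum_(i < n.+1) psX 'F_p i ^+ (2 * p ^ e).
Proof.
elim: e => [|e IH]; first by rewrite expr1; apply: eq_bigr => i _; rewrite muln1.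
rewrite expnS mulnC exprM IH -(pFrobenius_autE pchar_series) rmorph_sum.
by apply: eq_bigr => i _; rewrite /= pFrobenius_autE -exprM -mulnA [(_ * p)%N]mulnC.
Qed.

Lemma sum_squares_pow_eq0 e : tr (p ^ e) (f ^+ (p ^ e)) = 0.
Proof.
apply/ffunP => a; rewrite sum_squares_frob !ffunE pscoef_pure_sum big1 // => i _.
case: eqP => // /mnmP /(_ i); rewrite monE mulmnE mnm1E eqxx mul1n => aE.
have := ltn_ord (a i); rewrite aE ltnNge leq_pmull //.
Qed.

Lemma codim_sum_squares_frob q :
  (p ^ n.+1 * codim q f <= p * codim (p * q) f)%N.
Proof.
have fp : f ^+ p = \sum_(i < n.+1) psX 'F_p i ^+ (2 * p).
  by have := sum_squares_frob 1; rewrite expn1.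
apply: codim_frob; first exact: prime_gt0.
  move=> m; rewrite fp !pscoef_pure_sum; apply: eq_bigr => i _; congr (_%:R).
  congr nat_of_bool; apply/eqP/eqP => [h|->]; apply/mnmP => j;
    last by rewrite !mulmnE mulnA.
  move/mnmP/(_ j): h; rewrite !mulmnE mulnA => /eqP.
  by rewrite eqn_pmul2r ?prime_gt0 // => /eqP.
move=> m; rewrite fp pscoef_pure_sum => h.
apply: contrapT => nex; case/eqP: h; rewrite big1 // => i _.
case: eqP => // mE; case: nex; exists (U_(i) *+ 2)%MM.
by rewrite mE; apply/mnmP => j; rewrite !mulmnE mulnA.
Qed.

End PrimeField.

(** * Chains of primes: upper bound *)

Lemma expn_le_ffact K n : ((K - n) ^ n.+1 <= K ^_ n.+1)%N.
Proof.
elim: n K => [|n IH] K; first by rewrite subn0 expn1 ffactn1.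
case: K => [|K]; first by rewrite sub0n exp0n.
rewrite ffactSS expnS leq_mul //; first by rewrite leq_subr.
by rewrite subSS IH.
Qed.

(** The degrees in [K] are [n] and [n.+1]. For [K = n + M] the falling factorial is at least
    [M ^ n.+1], while [K + 1 <= 2 * M]; the remaining constants are collected in [e < M]. *)
Lemma bin_unbounded n c : exists K, (c * (K + 1) ^ n < 'C(K, n.+1))%N.
Proof.
pose e := ((n.+1)`! * c * 2 ^ n)%N; pose M := (e + n.+1)%N.
exists (n + M)%N; rewrite -(ltn_pmul2r (fact_gt0 n.+1)) bin_ffact.
have := expn_le_ffact (n + M) n; rewrite addKn; apply: leq_trans.
have M1 : ((n + M + 1) ^ n <= (2 * M) ^ n)%N.
  have : (n + M + 1 <= 2 * M)%N by rewrite /M; lia.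
  by move: (n + M + 1)%N => l; case: (n) => // n' lM; rewrite leq_exp2r.
apply: (@leq_ltn_trans (e * M ^ n)).
  have -> : (e * M ^ n = c * (2 * M) ^ n * (n.+1)`!)%N.
    by rewrite /e expnMn [RHS]mulnC !mulnA.
  by rewrite leq_mul2r leq_mul2l M1 !orbT.
by rewrite expnS ltn_pmul2r ?expn_gt0 /M ?addnS ?ltnS ?leq_addr.
Qed.

Section Chains.
Variables (F : fieldType) (N : nat).
Local Notation P := (mpseries N F).
Implicit Types (I J : P -> Prop) (f g : P).

Definition ideal_chain I l := exists C : nat -> P -> Prop,
  [/\ forall i, (i <= l)%N -> is_ideal (C i), forall g, I g -> C 0%N g &
      forall i, (i < l)%N -> (forall g, C i g -> C i.+1 g) /\
                             exists2 g, C i.+1 g & ~ C i g].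

(** The sum of [J] and the [k]-th power of the maximal ideal. *)
Definition thicken J k g := exists2 j, J j & ord_ge k (g - j).

Lemma thicken_ideal J k : is_ideal J -> is_ideal (thicken J k).
Proof.
move=> [J0 JM]; split; first by exists 0; rewrite // subrr; apply: ord_ge_zero.
move=> a x y [j Jj xj] [i Ji yi]; exists (a * j + i); first exact: JM.
by rewrite opprD addrACA -mulrBr; apply: ord_geD => //; apply: ord_geMl.
Qed.

Lemma ideal_chain_le I I' l l' : (forall g, I' g -> I g) -> (l' <= l)%N ->
  ideal_chain I l -> ideal_chain I' l'.
Proof.
move=> II' ll' [C [Cid IC Cinc]]; exists C; split=> [i il|g /II'/IC //|i il].
  by apply: Cid; apply: leq_trans ll'.
by apply: Cinc; apply: leq_trans ll'.
Qed.

Lemma thicken_le J k k' g : (k <= k')%N -> thicken J k' g -> thicken J k g.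
Proof. by move=> kk' [j Jj gj]; exists j => //; apply: ord_ge_le kk' gj. Qed.

(* Multiplication by x turns the first chain into a chain from J to J + (x). *)
Lemma ideal_chain_cat J J' x s : is_ideal J -> is_ideal J' ->
    (forall g, J g -> J' g) -> J' x ->
    (forall k a j, J j -> ord_ge k (x * a - j) ->
       exists2 j', J j' & ord_ge (k - s) (a - j')) ->
  forall k l1 l2, ideal_chain (thicken J (k - s)) l1 ->
    ideal_chain (thicken J' k) l2 -> ideal_chain (thicken J k) (l1 + l2).
Proof.
move=> Jid J'id JJ' J'x hs k l1 l2 [C1 [C1id JC1 C1inc]] [C2 [C2id JC2 C2inc]].
have Tid := thicken_ideal k Jid.
(* [D i] is [x * C1 i] plus the thickening of [J]. Inclusions stay strict by the bound for division
   by [x], and [D l1] lies in the thickening of [J'], where [C2] takes over. *)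
pose D i g := exists2 c, C1 i c & thicken J k (g - x * c).
have Did i : (i <= l1)%N -> is_ideal (D i).
  move=> il; have [[C0 CM] [T0 TM]] := (C1id i il, Tid); split.
    by exists 0; rewrite // mulr0 subrr.
  move=> a u v [c Cc uc] [d Cd vd]; exists (a * c + d); first exact: CM.
  have -> : a * u + v - x * (a * c + d) = a * (u - x * c) + (v - x * d).
    by rewrite !(mulrBr, mulrDr) opprD addrACA mulrCA.
  exact: TM.
have C1mono i g : (i <= l1)%N -> C1 0%N g -> C1 i g.
  by elim: i => // i IH il /(IH (ltnW il)); apply: (C1inc i il).1.
have Dinc i : (i < l1)%N -> (forall g, D i g -> D i.+1 g) /\ exists2 g,
  D i.+1 g & ~ D i g.
  move=> il; have [inc [c Cc nCc]] := C1inc i il; split.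
    by move=> g [d Cd gd]; exists d => //; apply: inc.
  exists (x * c); first by exists c => //; rewrite subrr; case: Tid.
  move=> [d Cd]; rewrite -mulrBr => -[j Jj /(hs _ _ _ Jj)[j' Jj' cdj]]; apply: nCc.
  have [C0 CM] := C1id i (ltnW il).
  rewrite -[c](subrK d) -[c - d]mul1r; apply: CM => //.
  by apply: C1mono; [exact: ltnW | apply: JC1; exists j'].
have DC2 g : D l1 g -> C2 0%N g.
  move=> [c _ [j Jj gj]]; apply: JC2; exists (c * x + j); last first.
    by rewrite mulrC opprD addrA.
  by case: J'id => _ J'M; apply: J'M => //; apply: JJ'.
exists (fun i => if (i < l1)%N then D i else C2 (i - l1)%N); split.
- move=> i il; case: ltnP => li; first exact/Did/ltnW.
  by apply: C2id; rewrite leq_subLR.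
- move=> g Tg; have D0 : D 0%N g.
    exists 0; last by rewrite mulr0 subr0.
    by case: (C1id 0%N (leq0n _)).
  by case: l1 DC2 D0 {JC1 C1inc C1id Did C1mono Dinc} => [|l1] //= DC2 /DC2.
move=> i il; have [i1|i1|i1] := ltngtP i.+1 l1.
- by apply: Dinc; apply: ltnW.
- by rewrite subSn //; apply: C2inc; rewrite ltn_subLR.
have [|inc [g Dg nDg]] := Dinc i; first by rewrite i1.
by rewrite i1 subnn -i1 in DC2 *; split=> [h Dh|]; [exact/DC2/inc | exists g => //;
  apply: DC2].
Qed.

Lemma prime_max_ideal J f : prime_ideal J -> J f -> pscoef0 f = 0.
Proof.
move=> [[J0 JM] J1 _] Jf; apply: contrapT => /eqP/psunit_ex[g fg]; apply: J1.
by rewrite -fg -[f * g]addr0 mulrC; apply: JM.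
Qed.

(** Induction from the top prime downwards and on [K], by Pascal's rule: a chain for the smaller
    prime at level [K] is followed by a chain for the next prime. *)
Lemma ideal_chain_growth d (J : nat -> P -> Prop) :
  (forall i, (i <= d)%N -> prime_ideal (J i)) ->
  (forall i, (i < d)%N -> (forall g, J i g -> J i.+1 g) /\ exists2 g,
    J i.+1 g & ~ J i g) ->
  exists s, forall K, ideal_chain (thicken (J 0%N) (s * K.+1)) 'C(K, d).
Proof.
move=> Jpr Jinc.
have colon i : exists s, (i < d)%N -> exists2 x, J i.+1 x &
    forall k a j, J i j -> ord_ge k (x * a - j) -> exists2 j',
      J i j' & ord_ge (k - s) (a - j').
  have [id|di] := ltnP i d; last by exists 0%N.
  have [_ [x Jx nJx]] := Jinc i id.
  have [s hs] := colon_ord_bound (Jpr i (ltnW id)) nJx.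
  by exists s => _; exists x.
(* One loss of order serves all primes; it is positive so that 1 lies outside the thickened top
   prime. *)
have [S hS] := choice colon; pose s := (\max_(i < d) S i).+1.
exists s => K; suff H i : (i <= d)%N -> forall K,
  ideal_chain (thicken (J (d - i)%N) (s * K.+1)) 'C(K, i).
  by have := H d (leqnn d) K; rewrite subnn.
elim: i => [|i IH] id {}K.
  have Jd := Jpr d (leqnn d); rewrite subn0 bin0.
  exists (fun i => if i is 0%N then thicken (J d) (s * K.+1) else fun=> True);
    split=> //.
    by move=> [|i] // _; apply: thicken_ideal; case: Jd.
  move=> [|i] // _; split=> //; exists 1 => // -[j /(prime_max_ideal Jd) j0 /(_ 0%MM)].
  rewrite mdeg0 mulnS pscoefB -/(pscoef0 j) j0 subr0 => /(_ (ltn0Sn _)) /= /eqP.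
  by rewrite eqxx oner_eq0.
have di : (d - i.+1 < d)%N by rewrite ltn_subrL (leq_trans _ id).
have diS : (d - i.+1).+1 = (d - i)%N by rewrite subnSK.
have Jid j : (j <= d)%N -> is_ideal (J j) by case/Jpr.
elim: K => [|K IHK].
  exists (fun=> thicken (J (d - i.+1)%N) (s * 1)); split=> // _ _.
  exact/thicken_ideal/Jid/ltnW.
have [x Jx hx] := hS _ di; rewrite diS in Jx.
have [JJ' _] := Jinc _ di; rewrite diS in JJ'.
rewrite binS; apply: (ideal_chain_cat (J' := J (d - i)%N) (x := x) (s := s)) => //.
- exact/Jid/ltnW.
- exact/Jid/leq_subr.
- move=> k a j Jj /hx[] // j' Jj' aj'; exists j' => //; apply: ord_ge_le aj'.
  by rewrite leq_sub2l // leqW // (leq_bigmax (Ordinal di)).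
- by rewrite [(s * K.+2)%N]mulnS addKn.
apply: ideal_chain_le (IH (ltnW id) K) => // g; apply: thicken_le.
by rewrite leq_mul2l leqnSn orbT.
Qed.

End Chains.

(** A monomial outside the box of side [k] has degree at least [k], so [J] thickened by [k] contains
    everything that is a multiple of the quadric modulo [k]-th powers of the variables. *)
Lemma sum_squares_chain_le (F : fieldType) n (J : mpseries n.+1 F -> Prop) k l :
  is_ideal J -> J (sum_squares F n) -> ideal_chain (thicken J k) l ->
  (l <= 2 * k ^ n)%N.
Proof.
move=> [J0 JM] Jf [C [Cid JC Cinc]]; apply: leq_trans (codim_le F n k).
apply: (chain_codim Cid _ Cinc) => g /memv_imgP[u _ gE]; apply: JC.
exists (sum_squares F n * untr u); first by rewrite mulrC -[_ * _]addr0; apply: JM.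
move=> m mk; have g0 : tr k (g - sum_squares F n * untr u) = 0.
  by rewrite trB gE -act_tr untrK subrr.
have mq i : (m i < k)%N by apply: leq_ltn_trans mk;
  rewrite mdegE (bigD1 i) //= leq_addr.
pose a : {ffun 'I_n.+1 -> 'I_k} := [ffun i => Ordinal (mq i)].
have -> : m = mon a by apply/mnmP => i; rewrite monE ffunE.
by move/ffunP/(_ a): g0; rewrite !ffunE.
Qed.

Lemma no_prime_chain (F : fieldType) n (J : nat -> mpseries n.+1 F -> Prop) :
  (forall i, (i <= n.+1)%N -> prime_ideal (J i)) ->
  (forall i, (i < n.+1)%N -> (forall g, J i g -> J i.+1 g) /\ exists2 g,
    J i.+1 g & ~ J i g) ->
  ~ J 0%N (sum_squares F n).
Proof.
move=> Jpr Jinc J0f; have [s hs] := ideal_chain_growth Jpr Jinc.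
have [K] := bin_unbounded n (2 * s ^ n).
rewrite ltnNge addn1 -mulnA -expnMn => /negP; apply.
by apply: sum_squares_chain_le (hs K); case: (Jpr 0%N).
Qed.

(** * Chains of primes: existence *)

(** Pigeonhole: the [(p + 1) / 2] squares and the equally many elements [-1 - y] with [y] a square
    must meet. *)
Lemma Fp_sum_two_squares p : prime p -> odd p ->
  exists a b : 'F_p, a ^+ 2 + b ^+ 2 = -1.
Proof.
move=> p_pr p_odd; pose m := p./2.
have pm : p = m.*2.+1 by rewrite -[LHS]odd_double_half p_odd.
pose h (i : 'I_m.+1) : 'F_p := (i : nat)%:R ^+ 2.
have nat_eq0 k : (k < p)%N -> (k%:R : 'F_p) = 0 -> k = 0%N.
  move=> kp /eqP; rewrite -(dvdn_pcharf (pchar_Fp p_pr)) => /dvdnP[[|l] //].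
  by rewrite mulSn => kE; move: kp; rewrite kE ltnNge leq_addr.
have h_inj : injective h.
  move=> i j /eqP; rewrite eqf_sqr => /orP[/eqP ij|].
    have wlog_eq (k l : nat) : (k <= l)%N -> (l < p)%N -> (k%:R : 'F_p) = l%:R -> k = l.
      move=> kl lp /eqP; rewrite eq_sym -subr_eq0 -natrB // => /eqP/nat_eq0 h0.
      by apply/eqP; rewrite eqn_leq kl -subn_eq0 h0 // (leq_ltn_trans (leq_subr _ _)).
    apply: val_inj => /=; have := ltn_ord i; have := ltn_ord j => jm im.
    case/orP: (leq_total i j) => le; first by apply: wlog_eq => //; lia.
    by apply/esym/wlog_eq => //; lia.
  rewrite -subr_eq0 opprK -natrD => /eqP /nat_eq0 ij0; apply: val_inj => /=.
  have := ltn_ord i; have := ltn_ord j => jm im.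
  have ij : (i + j < p)%N by rewrite [X in (_ < X)%N]pm; lia.
  by move/eqP: (ij0 ij); rewrite addn_eq0 => /andP[/eqP -> /eqP ->].
pose A := h @: setT; pose B := (fun x => -1 - x) @: A.
have cA : #|A| = m.+1 by rewrite card_imset // cardsT card_ord.
have cB : #|B| = m.+1 by rewrite card_imset // => x y /addrI/oppr_inj.
have : A :&: B != set0.
  have le : (#|A :|: B| <= p)%N by rewrite -[leqRHS](card_Fp p_pr) max_card.
  by rewrite -card_gt0; have := cardsUI A B; rewrite cA cB; lia.
case/set0Pn => x; rewrite inE => /andP[/imsetP[i _ xi] /imsetP[_ /imsetP[j _ ->] xj]].
by exists i%:R, j%:R; rewrite -[_ ^+ 2]xi xj subrK.
Qed.

Section Evaluation.
Variables (F : fieldType) (N : nat) (D : idomainType).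
Variables (phi : {rmorphism F -> D}) (c : 'I_N -> D).
Local Notation P := (mpseries N F).
Implicit Types (f g : P).

(** The extra variable records the degree, so that evaluation at [c] extends to power series one
    homogeneous part at a time. *)
Let psi (A : {mpoly F[N]}) : {poly D} :=
  mmap (polyC \o phi) (fun i => (c i)%:P * 'X) A.

Lemma mmap1_line m : mmap1 (fun i => (c i)%:P * 'X) m = (mmap1 c m)%:P * 'X^(mdeg m).
Proof.
rewrite /mmap1 mdegE rmorph_prod -prodrXr -big_split; apply: eq_bigr => i _ /=.
by rewrite exprMn rmorphXn.
Qed.

Lemma coef_psi_eq A B j :
  (forall m, mdeg m = j -> A@_m = B@_m) -> (psi A)`_j = (psi B)`_j.
Proof.
move=> AB; apply/eqP; rewrite -subr_eq0 -coefB /psi -raddfB /mmap coef_sum big1_seq //=.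
move=> m _; rewrite mmap1_line mulrA -rmorphM coefCM coefXn.
case: eqP => [jm|]; last by rewrite mulr0.
by rewrite mcoeffB AB ?subrr ?rmorph0 ?mul0r.
Qed.

(* The value at c of the homogeneous part of degree j. *)
Definition ev f j : D := (psi (pstrunc j.+1 f))`_j.

Lemma ev_trunc f d j : (j < d)%N -> ev f j = (psi (pstrunc d f))`_j.
Proof.
by move=> jd; apply: coef_psi_eq => m mj; rewrite !pstruncE ?mj.
Qed.

Lemma evM f g d : ev (f * g) d = \sum_(i < d.+1) ev f i * ev g (d - i).
Proof.
have -> : ev (f * g) d = (psi (pstrunc d.+1 f * pstrunc d.+1 g))`_d.
  apply: coef_psi_eq => m md; rewrite pstruncE ?md //.
  by apply: pscoefM_trunc; rewrite md.
rewrite /psi rmorphM coefM; apply: eq_bigr => i _.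
by rewrite (ev_trunc f (ltn_ord i)) (@ev_trunc g d.+1) // ltnS leq_subr.
Qed.

Lemma evD f g d : ev (f + g) d = ev f d + ev g d.
Proof.
rewrite /ev -coefD /psi -raddfD; apply: coef_psi_eq => m md.
by rewrite mcoeffD !pstruncE ?md.
Qed.

Lemma ev_zero d : ev 0 d = 0.
Proof. by apply: (addrI (ev 0 d)); rewrite -evD !addr0. Qed.

Lemma ev_sum J (r : seq J) (Q : pred J) (G : J -> P) d :
  ev (\sum_(i <- r | Q i) G i) d = \sum_(i <- r | Q i) ev (G i) d.
Proof.
by apply: (big_morph (fun f => ev f d)) => [f g|]; [exact: evD | exact: ev_zero].
Qed.

Lemma ev_mon m d : ev (psmon F m) d = if mdeg m == d then mmap1 c m else 0.
Proof.
have -> : ev (psmon F m) d = (psi 'X_[m])`_d.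
  apply: coef_psi_eq => m' md; rewrite pstruncE ?md // mcoeffX /= eq_sym.
  by case: eqP.
by rewrite /psi mmapX mmap1_line coefCM coefXn eq_sym; case: eqP; rewrite ?mulr1 ?mulr0.
Qed.

Lemma ev_const a d : ev (psconst N a) d = if d == 0%N then phi a else 0.
Proof.
have -> : ev (psconst N a) d = (psi a%:MP)`_d.
  apply: coef_psi_eq => m md; rewrite pstruncE ?md // mcoeffC /=.
  by case: eqP => _; rewrite ?mulr1 ?mulr0.
by rewrite /psi mmapC coefC.
Qed.

Lemma ev_constM a g d : ev (psconst N a * g) d = phi a * ev g d.
Proof.
rewrite evM big_ord_recl ev_const subn0 big1 ?addr0 // => i _.
by rewrite ev_const mul0r.
Qed.

Definition vanishing f := forall d, ev f d = 0.

(** This is the kernel of a ring morphism to power series in one variable over the domain [D]: the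
    lowest nonzero values of two factors multiply to a nonzero value. *)
Lemma vanishing_prime : prime_ideal vanishing.
Proof.
split.
- split=> [d|a f g f0 g0 d]; first exact: ev_zero.
  by rewrite evD g0 addr0 evM big1 // => i _; rewrite f0 mulr0.
- move=> /(_ 0%N); rewrite -psmon0 ev_mon mdeg0 eqxx mmap11 => /eqP.
  by rewrite oner_eq0.
move=> f g fg; have low h : ~ vanishing h ->
    exists2 i, ev h i != 0 & forall j, (j < i)%N -> ev h j = 0.
  move=> nh; have [i hi] : exists i, ev h i != 0.
    by apply: contrapT => nex; apply: nh => i; apply: contrapT => /eqP hi; apply: nex;
      exists i.
  have [i' hi' i'min] := ex_minnP (ex_intro (fun i => ev h i != 0) i hi).
  exists i' => // j ji; apply: contrapT => /eqP /i'min; lia.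
have [|/low[i fi flow]] := pselect (vanishing f); first by left.
have [|/low[j gj glow]] := pselect (vanishing g); first by right.
have ij : (i < (i + j).+1)%N by rewrite ltnS leq_addr.
have := fg (i + j)%N; rewrite evM (bigD1 (Ordinal ij)) //= addKn big1 ?addr0 =>
  [/eqP|k ki].
  by rewrite mulf_eq0 (negPf fi) (negPf gj).
have [lt|le] := ltnP k i; first by rewrite flow ?mul0r.
rewrite glow ?mulr0 //; have : i != k by apply: contra ki => /eqP ik; apply/eqP/val_inj.
by have := ltn_ord k; lia.
Qed.

End Evaluation.

Lemma ev_rmorph (F : fieldType) N (D D' : idomainType) (phi : {rmorphism F -> D})
    (phi' : {rmorphism F -> D'}) (theta : {rmorphism D ->
      D'}) c c' (f : mpseries N F) d :
  (forall a, theta (phi a) = phi' a) -> (forall i, theta (c i) = c' i) ->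
  ev phi' c' f d = theta (ev phi c f d).
Proof.
move=> thphi thc; rewrite /ev -coef_map /mmap /=; congr ((polyseq _)`__).
rewrite rmorph_sum; apply: eq_bigr => m _ /=.
rewrite rmorphM /= map_polyC /= thphi; congr (_ * _).
rewrite !mmap1_line rmorphM /= map_polyC /= map_polyXn; congr (_%:P * _).
by rewrite /mmap1 rmorph_prod; apply: eq_bigr => i _; rewrite rmorphXn thc.
Qed.

(** * A chain of primes from degenerating generic points *)

Section Chain.
Variables (p r : nat).
Hypotheses (p_pr : prime p) (p_odd : odd p).
Local Notation F := 'F_p.
Local Notation P := (mpseries r.+3 F).
Local Notation D := {mpoly F[r.+1]}.
Variables (a b : F).
Hypothesis ab : a ^+ 2 + b ^+ 2 = -1.

(* The points s (a, b, 1, 0) + (a, b, -1, 0) + w_0 (b, -a, 0, 0) + (0, 0, 0, w)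
   of the quadric, where (a, b, 1) and (a, b, -1) span a hyperbolic plane
   orthogonal to (b, -a, 0). *)
Definition pt (w : nat -> D) (i : nat) : D :=
  let s := 4^-1 *: (\sum_(j < r) w j.+1 ^+ 2 - w 0%N ^+ 2) in
  match i with
  | 0 => a *: s + a%:MP + b *: w 0%N
  | 1 => b *: s + b%:MP - a *: w 0%N
  | 2 => s - 1
  | i.+3 => w i.+1
  end.

Lemma pt_isotropic w : \sum_(i < r.+3) pt w i ^+ 2 = 0.
Proof.
pose S := \sum_(j < r) w j.+1 ^+ 2; pose s := 4^-1 *: (S - w 0%N ^+ 2).
have -> : \sum_(i < r.+3) pt w i ^+ 2 =
    pt w 0 ^+ 2 + (pt w 1 ^+ 2 + (pt w 2 ^+ 2 + S)) by rewrite !big_ord_recl.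
have four0 : (4 : F) != 0.
  rewrite -(dvdn_pcharf (pchar_Fp p_pr)) -[4%N]/(2 * 2)%N Euclid_dvdM // orbb.
  by rewrite dvdn_prime2 //; apply: contraL p_odd => /eqP ->.
have sE : S - w 0%N ^+ 2 - s *+ 4 = 0.
  by rewrite -scaler_nat scalerA mulfV // scale1r subrr.
have abE : a%:MP_[r.+1] ^+ 2 + b%:MP ^+ 2 + 1 = 0.
  by rewrite -!rmorphXn -rmorphD /= ab rmorphN1 addNr.
rewrite /pt -/S -/s -!mul_mpolyC.
(* The first factor on the right vanishes by [ab], the last summand by the choice of [s]. *)
have -> : forall A B W : D, (A * s + A + B * W) ^+ 2 + ((B * s + B - A * W) ^+ 2 +
    ((s - 1) ^+ 2 + S)) =
    (A ^+ 2 + B ^+ 2 + 1) * ((s + 1) ^+ 2 + W ^+ 2) + (S - W ^+ 2 - s *+ 4).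
  by move=> A B W; ring.
by rewrite abE sE mul0r addr0.
Qed.

Definition wvar (j k : nat) : D :=
  if ((inord k : 'I_r.+1) < j)%N then 0 else 'X_(inord k).

Definition kill (j : nat) : D -> D :=
  mmap (@mpolyC r.+1 F) (fun i : 'I_r.+1 => if (i < j)%N then 0 else 'X_i).
HB.instance Definition _ j := GRing.RMorphism.on (kill j).

Lemma kill_wvar j k : kill j.+1 (wvar j k) = wvar j.+1 k.
Proof.
rewrite /wvar; case: ifP => [lt|_]; first by rewrite ltnS ltnW // rmorph0.
by rewrite /kill mmapX mmap1U.
Qed.

Lemma kill_pt j i : kill j.+1 (pt (wvar j) i) = pt (wvar j.+1) i.
Proof.
have killZ (e : F) x : kill j.+1 (e *: x) = e *: kill j.+1 x.
  by rewrite -!mul_mpolyC rmorphM /= {1}/kill mmapC.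
have killS : kill j.+1 (4^-1 *: (\sum_(i < r) wvar j i.+1 ^+ 2 - wvar j 0 ^+ 2)) =
    4^-1 *: (\sum_(i < r) wvar j.+1 i.+1 ^+ 2 - wvar j.+1 0 ^+ 2).
  rewrite killZ rmorphB rmorph_sum rmorphXn /= kill_wvar; congr (_ *: (_ - _)).
  by apply: eq_bigr => k _; rewrite rmorphXn /= kill_wvar.
case: i => [|[|[|i]]]; rewrite /pt; last exact: kill_wvar.
- by rewrite !rmorphD /= (killZ a) (killZ b) killS kill_wvar /kill mmapC.
- by rewrite rmorphB rmorphD /= (killZ a) (killZ b) killS kill_wvar /kill mmapC.
by rewrite rmorphB rmorph1 /= killS.
Qed.

(** The first [j] parameters of the generic point are set to 0, and the maximal ideal comes after
    the last of these points. Indices 0 to [r.+2] give a chain of length [r.+2], the value of [n]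
    here. *)
Definition flag_ideal (j : nat) : P -> Prop :=
  if (j <= r.+1)%N then vanishing (@mpolyC r.+1 F) (fun i : 'I_r.+3 => pt (wvar j) i)
  else fun g => pscoef0 g = 0.

Lemma flag_ideal_prime j : prime_ideal (flag_ideal j).
Proof.
rewrite /flag_ideal; case: ifP => _; first exact: vanishing_prime.
split.
- split=> [|c x y x0 y0]; first exact: (rmorph0 (@pscoef0 _ _)).
  by rewrite pscoef0D pscoef0M (x0 : _ = 0) (y0 : _ = 0) mulr0 addr0.
- by move=> /eqP; rewrite (rmorph1 (@pscoef0 _ _)) oner_eq0.
by move=> x y /eqP; rewrite pscoef0M mulf_eq0 => /orP[/eqP|/eqP]; [left|right].
Qed.

Lemma flag_ideal_quadric j : flag_ideal j (sum_squares F r.+2).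
Proof.
rewrite /flag_ideal; case: ifP => _; last first.
  rewrite /pscoef0 pscoef_pure_sum big1 // => i _; case: eqP => // /mnmP/(_ i).
  by rewrite mulmnE mnm0E mnm1E eqxx.
move=> d; rewrite ev_sum; have [d2|d2] := eqVneq d 2.
  rewrite -[RHS](pt_isotropic (wvar j)); apply: eq_bigr => i _.
  rewrite psX_mon psmonX ev_mon mdegMn mdeg1 d2 eqxx.
  rewrite /mmap1 (bigD1 i) //= mulmnE mnm1E eqxx big1 ?mulr1 // => k ki.
  by rewrite mulmnE mnm1E eq_sym (negPf ki).
rewrite big1 // => i _; rewrite psX_mon psmonX ev_mon mdegMn mdeg1.
by rewrite eq_sym (negPf d2).
Qed.

(** A linear form reads off the parameter [w j], and thus separates consecutive ideals. For [j = 0]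
    it is [b * x_0 - a * x_1], whose value [(a ^ 2 + b ^ 2) * w 0] accounts for the sign. *)
Lemma coordinate_form j : (j < r.+1)%N -> exists g : P, forall w d,
  ev (@mpolyC r.+1 F) (fun i : 'I_r.+3 => pt w i) g d = if d == 1%N then - w j else 0.
Proof.
have evX w (i : 'I_r.+3) d : ev (@mpolyC r.+1 F) (fun i : 'I_r.+3 => pt w i)
    (psX F i) d = if d == 1%N then pt w i else 0.
  by rewrite psX_mon ev_mon mdeg1 mmap1U eq_sym.
case: j => [_|j jr].
  pose i1 : 'I_r.+3 := lift ord0 ord0.
  exists (psconst _ b * psX F ord0 + psconst _ (- a) * psX F i1) => w d.
  rewrite evD !ev_constM !evX; case: eqP => _; last by rewrite !mulr0 addr0.
  rewrite /pt /=; set s := 4^-1 *: _; set W := w 0%N; rewrite -!mul_mpolyC.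
  have abE : a%:MP_[r.+1] ^+ 2 + b%:MP ^+ 2 = -1.
    by rewrite -!rmorphXn -rmorphD /= ab rmorphN1.
  rewrite -[RHS]mulN1r -abE rmorphN /=.
  by move: a%:MP b%:MP => A B; ring.
have j3 : (j.+3 < r.+3)%N by [].
exists (psconst _ (- 1) * psX F (Ordinal j3)) => w d.
rewrite ev_constM evX rmorphN1 /=; case: eqP => _; last by rewrite mulr0.
by rewrite mulN1r.
Qed.

Lemma flag_ideal_strict j : (j < r.+2)%N ->
  (forall g, flag_ideal j g -> flag_ideal j.+1 g) /\
  exists2 g, flag_ideal j.+1 g & ~ flag_ideal j g.
Proof.
(* For [j = r.+1] all parameters are 0 and the point is [(a, b, -1, 0, ..., 0)]: the third variable
   lies in the maximal ideal but does not vanish there. *)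
rewrite ltnS leq_eqVlt => /predU1P[->|jr].
  split=> [g /(prime_max_ideal (flag_ideal_prime _))|].
    by rewrite /flag_ideal ltnn.
  have i2 : (2 < r.+3)%N by [].
  exists (psX F (Ordinal i2)); first by rewrite /flag_ideal ltnn pscoef0X.
  rewrite /flag_ideal leqnn => /(_ 1%N); rewrite psX_mon ev_mon mdeg1 mmap1U /=.
  have w0 k : wvar r.+1 k = 0 by rewrite /wvar ltn_ord.
  rewrite w0 big1 => [|k _]; last by rewrite w0 expr0n.
  rewrite expr0n subr0 scaler0 sub0r => /eqP; rewrite oppr_eq0.
  by rewrite oner_eq0.
have jr' := ltnW jr; rewrite /flag_ideal jr jr'; split=> [g gj d|].
  rewrite (ev_rmorph (phi := @mpolyC r.+1 F) (theta := kill j.+1)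
    (c := fun i : 'I_r.+3 => pt (wvar j) i)) ?gj ?rmorph0 // => [e|i].
    exact: mmapC.
  exact: kill_pt.
have [g hg] := coordinate_form jr; exists g => [d|/(_ 1%N)]; rewrite hg /wvar inordK //.
  by rewrite ltnSn oppr0 if_same.
rewrite ltnn eqxx => /eqP; rewrite oppr_eq0 => /eqP/(congr1 (mcoeff U_(inord j))).
by rewrite mcoeffX eqxx mcoeff0 => /eqP; rewrite oner_eq0.
Qed.

End Chain.

(** * Lengths and dimension *)

Section MaxChain.
Variables (T : Type) (Q : classical_sets.set (classical_sets.set T)).

Lemma max_chainE k : has_chain Q k -> (forall j, has_chain Q j -> (j <= k)%N) ->
  max_chain Q = k.
Proof.
move=> Qk kmax; apply: classical_sets.xget_unique; first by split.
move=> j [Qj jmax]; apply/eqP; rewrite eqn_leq kmax //=; exact: jmax.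
Qed.

Lemma has_chain_nat k (C : nat -> classical_sets.set T) :
  (forall i, (i <= k)%N -> Q (C i)) ->
  (forall i, (i < k)%N -> (forall x, C i x -> C i.+1 x) /\ exists2 x,
    C i.+1 x & ~ C i x) ->
  has_chain Q k.
Proof.
move=> QC Cinc; exists C; split=> [i|i j ij]; first by apply: QC; rewrite -ltnS.
have mono d : (i + d <= k)%N -> forall x, C i x -> C (i + d)%N x.
  elim: d => [|d IH] id x Cx; first by rewrite addn0.
  by rewrite addnS; apply: (Cinc _ _).1; rewrite -?addnS //; apply: IH => //;
    rewrite ltnW // -addnS.
have jk : (j <= k)%N by rewrite -ltnS.
have [d jE] : exists d, (j = i + d.+1 :> nat)%N.
  by exists (j - i.+1)%N; rewrite addnS -addSn subnKC.
rewrite jE in jk *; split; first exact: mono.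
move=> sub; have [|inc [x Cx nCx]] := Cinc (i + d)%N; first by rewrite -addnS.
by apply: nCx; apply: mono; [rewrite ltnW // -addnS | apply: sub; rewrite addnS].
Qed.

Lemma nat_has_chain k : has_chain Q k -> exists C : nat -> classical_sets.set T,
  (forall i, (i <= k)%N -> Q (C i)) /\
  (forall i, (i < k)%N -> (forall x, C i x -> C i.+1 x) /\ exists2 x,
    C i.+1 x & ~ C i x).
Proof.
move=> [C [QC Cinc]]; exists (fun i => C (inord i)); split=> [i _ //|i ik].
have [|sub nsub] := Cinc (inord i) (inord i.+1).
  by rewrite !inordK // ltnS ltnW.
split=> //; apply: contrapT => nex; apply: nsub => x Cx; apply: contrapT => nCx.
by apply: nex; exists x.
Qed.

End MaxChain.

Section ModuleLength.
Variables (F : fieldType) (N q : nat) (A : comNzRingType) (M : lmodType A).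
Local Notation P := (mpseries N F).
Local Notation E := {ffun {ffun 'I_N -> 'I_q} -> F^o}.
Variables (pi : P -> A) (rho : P -> M) (U : {vspace E}).
Hypotheses (pi_surj : forall a, exists g, a = pi g) (rho_surj : forall x, exists g,
  x = rho g).
Hypotheses (rhoD : {morph rho : f g / f + g}) (rhoM : forall f g,
  rho (f * g) = pi f *: rho g).
Hypotheses (rho0 : forall g, rho g = 0 <-> tr q g \in U) (U_stable : stable U).

(** The flag of stable subspaces above [U] gives a chain of this length; any chain of submodules
    pulls back along [rho] to ideals bounded by [chain_codim]. *)
Lemma module_length_codim : module_length M = (\dim {:E} - \dim U)%N.
Proof.
have rhoB f g : rho (f - g) = rho f - rho g.
  by apply: (addIr (rho g)); rewrite -rhoD !subrK.
have rho_eq f g : rho f = rho g -> tr q (f - g) \in U.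
  by move=> fg; apply/rho0; rewrite rhoB fg subrr.
have [s [C [[sz sp C0 Cst] Cinc]]] := stable_flag U_stable.
have -> : (\dim {:E} - \dim U)%N = size s by rewrite -sz addnK.
have UC i : (i <= size s)%N -> (U <= C i)%VS.
  elim: i => [|i IH] il; first by rewrite C0.
  by apply: subv_trans (Cinc i il); apply: IH; apply: ltnW.
apply: max_chainE => [|l /nat_has_chain[K [Kid Kinc]]].
  pose K i (x : M) := exists2 g, x = rho g & tr q g \in C i.
  have KE i g : (i <= size s)%N -> K i (rho g) <-> tr q g \in C i.
    move=> il; split=> [[h gh hC]|]; last by exists g.
    rewrite -[g](subrK h) trD rpredD //; apply: (subvP (UC i il)); exact: rho_eq.
  apply: (@has_chain_nat _ _ _ K) => i il.
    split; first by exists 0; rewrite ?tr0 ?mem0v //; apply/esym/rho0;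
      rewrite tr0 mem0v.
    move=> a x y [f -> fC] [g -> gC]; have [h ->] := pi_surj a.
    exists (h * f + g); first by rewrite rhoD rhoM.
    by rewrite trD rpredD // -act_tr; apply: (Cst i il).1.
  split=> [_ [g -> gC]|]; first by exists g => //; apply: (subvP (Cinc i il)).
  have [u uC nuC] : exists2 u, u \in C i.+1 & u \notin C i.
    apply/subvPn; apply/negP => /dimvS.
    by rewrite (Cst _ il).2 (Cst _ (ltnW il)).2 leq_add2l ltnn.
  exists (rho (untr u)); first by apply/KE; rewrite ?untrK.
  by move/(KE _ _ (ltnW il)); rewrite untrK; apply/negP.
rewrite -[size s](addnK (\dim U)) sz.
apply: (@chain_codim _ _ _ _ (fun i g => K i (rho g))) => [i il|g gU|i il].
- have [K0 KM] := Kid i il; split; first by rewrite (rho0 0).2 // tr0 mem0v.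
  by move=> a x y; rewrite rhoD rhoM; apply: KM.
- by rewrite (rho0 g).2 //; case: (Kid 0%N (leq0n _)).
have [inc [x Kx nKx]] := Kinc i il; split=> [g|]; first exact: inc.
by have [g xE] := rho_surj x; exists g; rewrite -xE.
Qed.
End ModuleLength.

(** Each monomial outside the box is assigned to one variable of exponent at least [q]; the choice
    by [pick] counts it exactly once. *)
Lemma box_decomposition (R : comNzRingType) N q (g : mpseries N R) :
  (forall m : 'X_{1..N}, (forall i, (m i < q)%N) -> pscoef g m = 0) ->
  exists h : 'I_N -> mpseries N R, g = \sum_i psX R i ^+ q * h i.
Proof.
move=> g0; pose pk (m : 'X_{1..N}) := [pick i | (q <= m i)%N].
exists (fun i => MPSeries (fun m : 'X_{1..N} =>
  if pk (m + U_(i) *+ q)%MM == Some i then pscoef g (m + U_(i) *+ q)%MM else 0)).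
apply: pseriesP => m; rewrite pscoef_sum.
have termE i : pscoef (psX R i ^+ q * MPSeries (fun m : 'X_{1..N} =>
  if pk (m + U_(i) *+ q)%MM == Some i
    then pscoef g (m + U_(i) *+ q)%MM else 0)) m =
    if pk m == Some i then pscoef g m else 0.
  rewrite psX_mon psmonX pscoef_monM /=; case: ifP => [im|/negP im];
    first by rewrite submK.
  case: eqP => // pkm; case: im; apply/mnm_lepP => j; rewrite mulmnE mnm1E.
  case: eqP => [<-|_]; rewrite ?mul1n ?mul0n //.
  by move: pkm; rewrite /pk; case: pickP => // k qk [<-].
under eq_bigr do rewrite termE; rewrite /pk; case: pickP => [i qi|nq].
  rewrite (bigD1 i) //= eqxx big1 ?addr0 // => j ji.
  by rewrite (inj_eq Some_inj) eq_sym (negPf ji).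
rewrite big1 => [|i _]; last by [].
by rewrite g0 // => i; rewrite ltnNge nq.
Qed.

(** * Frobenius powers and primes of the quadric ring *)

Section QuadricRing.
Variables (p n : nat).
Hypothesis p_pr : prime p.
Local Notation F := 'F_p.
Local Notation P := (mpseries n.+1 F).
Local Notation A := (quadric_ring p n).
Local Notation f := (sum_squares F n).

Definition qpi : P -> A := \pi_{ideal_quot (@quadric_ideal p n)}%qT.
HB.instance Definition _ := GRing.RMorphism.on qpi.

Lemma qpi_surj a : exists g, a = qpi g.
Proof. by exists (repr a); rewrite /qpi reprK. Qed.

Lemma ideal_gen_single (R : comNzRingType) (x y : R) :
  ideal_gen (classical_sets.set1 x) y -> exists z, y = z * x.
Proof.
move=> /(_ (fun y => exists z, y = z * x)); apply; split=> [|_ ->]; last first.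
  by exists 1; rewrite mul1r.
split; first by exists 0; rewrite mul0r.
by move=> a _ _ [u ->] [v ->]; exists (a * u + v); rewrite mulrDl mulrA.
Qed.

Lemma qpi_eq0 g : qpi g = 0 <-> exists h, g = h * f.
Proof.
split=> [g0|[h ->]].
  have : g \in @quadric_ideal p n.
    by rewrite -[g]subr0 Quotient.idealrBE; apply/eqP;
      rewrite -/(qpi g) g0 -/(qpi 0) raddf0.
  by move/ideal_predP/ideal_gen_single.
have : h * f \in @quadric_ideal p n.
  apply: ideal_predM; apply/ideal_predP; exact: classical_sets.sub_gen_smallest.
by rewrite -[h * f]subr0 Quotient.idealrBE => /eqP;
  rewrite -/(qpi _) -/(qpi 0) raddf0 subr0.
Qed.

Lemma frobenius_ideal_trunc e g :
  ideal_gen (@frobenius_power (quadric_local p n) (p ^ e)) (qpi g) <->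
  tr (p ^ e) g \in limg (act (p ^ e) f).
Proof.
set q := (p ^ e)%N; set S := @frobenius_power _ q.
have q_gt0 : (0 < q)%N by rewrite expn_gt0 prime_gt0.
have trX i h : tr q (psX F i ^+ q * h) = 0.
  apply/ffunP => a; rewrite !ffunE psX_mon psmonX pscoef_monM;
    case: ifP => // /mnm_lepP/(_ i).
  by rewrite mulmnE mnm1E eqxx mul1n monE leqNgt ltn_ord.
split=> [|/memv_imgP[u _ gE]].
  pose T x := exists2 g, x = qpi g & tr q g \in limg (act q f).
  have Tid : is_ideal T.
    split; first by exists 0; rewrite raddf0 ?mem0v.
    move=> a _ _ [u -> uf] [v -> vf]; have [h ->] := qpi_surj a.
    exists (h * u + v); first by rewrite raddfD /= rmorphM.
    by rewrite trD rpredD // -act_tr; apply: stable_limg.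
  have sub x : S x -> T x.
    apply; split=> // _ [_ [u u0 <-] <-].
    (* With box side 1, a series without constant term is a combination of the variables; additivity
       of Frobenius then puts its [q]-th power in the ideal of their [q]-th powers. *)
    have [|h uE] := @box_decomposition _ n.+1 1 u.
      move=> m m1; rewrite (_ : m = 0%MM) //; apply/mnmP => i; rewrite mnm0E.
      by apply/eqP; rewrite -leqn0 -ltnS.
    exists (u ^+ q); first by rewrite rmorphXn.
    have qE (v : P) : v ^+ q = iter e (pFrobenius_aut (pchar_series n p_pr)) v.
      by rewrite /q; elim: (e) => [|k IH]; rewrite ?expr1 //= -IH pFrobenius_autE
        -exprM mulnC expnS.
    have -> : u ^+ q = \sum_i psX F i ^+ q * h i ^+ q.
      rewrite uE qE (_ : iter _ _ _ = \sum_i iter e (pFrobenius_aut (pchar_series n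
        p_pr)) (psX F i ^+ 1 * h i)).
        by apply: eq_bigr => i _; rewrite -qE exprMn expr1.
      by elim: (e) => //= k ->; rewrite rmorph_sum.
    by rewrite (raddf_sum (@tr F n.+1 q)) big1 ?mem0v // => i _; apply: trX.
  move=> /(_ T (conj Tid sub))[g' gg' g'f].
  have /qpi_eq0[h gE] : qpi (g - g') = 0 by rewrite raddfB /= gg' subrr.
  rewrite -[g](subrK g') trD rpredD // gE mulrC -act_tr.
  exact/memv_img/memvf.
have g0 : tr q (g - untr u * f) = 0 by rewrite trB gE mulrC -act_tr untrK subrr.
have [m mq|h hE] := @box_decomposition _ _ q (g - untr u * f).
  pose a : {ffun 'I_n.+1 -> 'I_q} := [ffun i => Ordinal (mq i)].
  have -> : m = mon a by apply/mnmP => i; rewrite monE ffunE.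
  by move/ffunP/(_ a): g0; rewrite !ffunE.
have -> : qpi g = \sum_i qpi (h i) * qpi (psX F i) ^+ q.
  rewrite -[g](subrK (untr u * f)) hE raddfD /= (_ : qpi (untr u * f) = 0); last first.
    by apply/qpi_eq0; exists (untr u).
  rewrite addr0 rmorph_sum; apply: eq_bigr => i _.
  by rewrite rmorphM rmorphXn mulrC.
move=> I [[I0 IM] SI]; apply: big_ind => // [x y Ix Iy|i _].
  by rewrite -[x]mul1r; apply: IM.
rewrite -[_ * _]addr0; apply: IM => //; apply: SI => J [Jid]; apply.
exists (qpi (psX F i)) => //; exists (psX F i) => //; exact: pscoef0X.
Qed.

Lemma quadric_length e :
  module_length (quotmod (@frobenius_power (quadric_local p n) (p ^ e))) =
  codim (p ^ e) f.
Proof.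
set S := @frobenius_power _ _.
pose cls (x : A) : quotmod S := \pi_{ideal_quot (ideal_pred S)}%qT x.
have clsD : {morph cls : x y / x + y} by exact: raddfD.
have cls00 : cls 0 = 0 by apply: (addIr (cls 0)); rewrite -clsD !add0r.
have cls0 x : cls x = 0 <-> ideal_gen S x.
  split=> [x0|/ideal_predP].
    apply/ideal_predP; rewrite -[x]subr0 Quotient.idealrBE.
    by apply/eqP; rewrite -/(cls x) x0 -/(cls 0) cls00.
  by rewrite -{1}[x]subr0 Quotient.idealrBE => /eqP; rewrite -/(cls x) -/(cls 0) cls00.
apply: (@module_length_codim F n.+1 (p ^ e) A (quotmod S) qpi
  (fun g => cls (qpi g)) (limg (act (p ^ e) f))).
- exact: qpi_surj.
- move=> x; have [g gE] := qpi_surj (repr x : A); exists g.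
  by rewrite -gE /cls reprK.
- by move=> g h; rewrite raddfD clsD.
- move=> g h; rewrite rmorphM; apply/esym; exact: quotmod_scaleE.
- by move=> g; rewrite cls0; apply: frobenius_ideal_trunc.
exact: stable_limg.
Qed.

Lemma quadric_prime_comap (J : classical_sets.set A) :
  prime_ideal J -> prime_ideal (fun g => J (qpi g)).
Proof.
move=> [[J0 JM] J1 JP]; split.
- split; first by rewrite raddf0.
  by move=> a x y Jx Jy; rewrite raddfD /= rmorphM; apply: JM.
- by rewrite rmorph1.
by move=> x y; rewrite rmorphM; apply: JP.
Qed.

Lemma quadric_prime_map (J : P -> Prop) : prime_ideal J -> J f ->
  exists2 K : classical_sets.set A, prime_ideal K & forall g, K (qpi g) <-> J g.
Proof.
move=> [[J0 JM] J1 JP] Jf; pose K (x : A) := exists2 g, x = qpi g & J g.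
have KE g : K (qpi g) <-> J g.
  split=> [[h gh Jh]|]; last by exists g.
  have /qpi_eq0[k kE] : qpi (g - h) = 0 by rewrite raddfB /= gh subrr.
  by rewrite -[g](subrK h) kE; apply: JM.
exists K => //; split.
- split; first by exists 0; rewrite ?raddf0.
  move=> a _ _ [u -> Ju] [v -> Jv]; have [h ->] := qpi_surj a.
  by exists (h * u + v); [rewrite raddfD /= rmorphM | apply: JM].
- by rewrite -(rmorph1 qpi) => /KE.
move=> x y; have [[g ->] [h ->]] := (qpi_surj x, qpi_surj y).
by rewrite -rmorphM => /KE /JP[] ?; [left | right]; apply/KE.
Qed.

End QuadricRing.

Lemma krull_dim_quadric p n : prime p -> odd p -> (2 <= n)%N ->
  krull_dim (quadric_ring p n) = n.
Proof.
case: n => [|[|r]] // p_pr p_odd _.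
apply: max_chainE => [|k /nat_has_chain[K [Kpr Kinc]]]; last first.
  rewrite leqNgt; apply/negP => nk.
  apply: (@no_prime_chain 'F_p r.+2 (fun i g => K i (qpi g))) => [i il|i il|].
  - by apply/quadric_prime_comap/Kpr; rewrite (leq_trans il).
  - have [inc [x Kx nKx]] := Kinc i (leq_trans il nk); split=> [g|]; first exact: inc.
    by have [g xE] := qpi_surj x; exists g; rewrite -xE.
  have [[K0 _] _ _] := Kpr 0%N (leq0n _).
  by rewrite (qpi_eq0 _).2 //; exists 1; rewrite mul1r.
have [a [b ab]] := Fp_sum_two_squares p_pr p_odd.
have /choice[K hK] j : exists K : classical_sets.set (quadric_ring p r.+2),
    prime_ideal K /\ forall g, K (qpi g) <-> @flag_ideal p r a b j g.
  have [K Kpr KE] := quadric_prime_map (flag_ideal_prime r a b j)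
    (@flag_ideal_quadric p r p_pr p_odd a b ab j).
  by exists K.
apply: (@has_chain_nat _ _ _ K) => i il; first exact: (hK i).1.
have [inc [g gi ngi]] := flag_ideal_strict ab il.
split=> [x|]; last by exists (qpi g); rewrite ?(hK _).2.
by have [h ->] := qpi_surj x => /(hK i).2/inc/(hK i.+1).2.
Qed.

End QuadricAlgebra.

(** * The limit *)

From mathcomp Require Import all_classical all_reals all_analysis.
Import numFieldNormedType.Exports.

Lemma bernoulli_ge (K : realDomainType) (y : K) n : 0 <= y ->
  1 + n%:R * (y - 1) <= y ^+ n.
Proof.
move=> y0; elim: n => [|n IH]; first by rewrite expr0 mul0r addr0.
rewrite exprS; apply: le_trans (ler_wpM2l y0 IH); rewrite -subr_ge0 -natr1.
have -> : y * (1 + n%:R * (y - 1)) - (1 + (n%:R + 1) * (y - 1)) = n%:R * (y - 1) ^+ 2.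
  by ring.
by rewrite mulr_ge0 // sqr_ge0.
Qed.

(** The quotients are nondecreasing and bounded, so each is at most the limit [l]. Bernoulli's
    inequality makes the loss from [d] of order [1 / p ^ e], so [1 + C - l] times [p ^ e] would stay
    bounded if it were positive. *)
Lemma limn_ge_of_growth (K : realType) (L : nat -> nat) p n c d : (1 < p)%N ->
  (forall e, (p ^ n * L e <= L e.+1)%N) ->
  (forall e, (L e <= 2 * (p ^ e) ^ n)%N) ->
  (forall e, (0 < e)%N -> (n`! * (p ^ e) ^ n + c * (p ^ e - d) ^ n <= n`! * L e)%N) ->
  1 + c%:R / n`!%:R <= limn (fun e => (L e)%:R / (p ^ (e * n))%:R : K).
Proof.
move=> p1 Linc Lub Llb; set a := fun e => _.
have pn_gt0 e : 0 < (p ^ e)%:R :> K by rewrite ltr0n expn_gt0 ltnW.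
have aE e : a e = (L e)%:R / (p ^ e)%:R ^+ n by rewrite /a expnM natrX.
have a_nd : nondecreasing_seq a.
  apply/nondecreasing_seqP => e; rewrite !aE ler_pdivrMr ?exprn_gt0 // mulrAC.
  rewrite ler_pdivlMr ?exprn_gt0 // expnS natrM exprMn mulrA.
  apply: ler_wpM2r; first by rewrite exprn_ge0 // ltW.
  by rewrite mulrC -natrX -natrM ler_nat.
have a_cvg : cvgn a.
  apply: nondecreasing_is_cvgn => //; exists 2 => _ [e _ <-].
  by rewrite aE ler_pdivrMr ?exprn_gt0 // -natrX -natrM ler_nat.
have f_gt0 : 0 < n`!%:R :> K by rewrite ltr0n fact_gt0.
set l := limn a.
pose C : K := c%:R / n`!%:R.
have C0 : 0 <= C by rewrite divr_ge0.
have bound e : (0 < e)%N -> (1 + C - l) * e%:R <= C * n%:R * d%:R.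
  move=> e0; have le_l : a e <= l by apply: nondecreasing_cvgn_le.
  pose q : K := (p ^ e)%:R; have q0 : 0 < q by apply: pn_gt0.
  (* The natural subtraction stops at 0, which keeps [y] nonnegative while [q - d <= y * q] still
     holds. *)
  pose y : K := (p ^ e - d)%N%:R / q.
  have y0 : 0 <= y by rewrite divr_ge0 // ltW.
  have y1 : q - d%:R <= y * q.
    rewrite divfK ?gt_eqF // lerBlDr -natrD ler_nat; lia.
  have aC : 1 + C * y ^+ n <= a e.
    rewrite aE ler_pdivlMr ?exprn_gt0 // -/q mulrDl mul1r /C.
    rewrite -(ler_pM2l f_gt0) mulrDr expr_div_n.
    have -> : n`!%:R * (c%:R / n`!%:R * ((p ^ e - d)%N%:R ^+ n / q ^+ n) * q ^+ n) =
        c%:R * (p ^ e - d)%N%:R ^+ n.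
      have qn0 : q ^+ n != 0 by rewrite expf_neq0 // gt_eqF.
      by rewrite -[_ * _ * q ^+ n]mulrA (divfK qn0) mulrA [_ * (_ / _)]mulrC divfK //
        gt_eqF.
    by rewrite -!natrX -!natrM -natrD ler_nat Llb.
  have yn := bernoulli_ge n y0.
  have Cy : 1 + C * (1 + n%:R * (y - 1)) <= l.
    by apply: le_trans le_l; apply: le_trans aC; rewrite lerD2l ler_wpM2l.
  have eq : e%:R <= q by rewrite /q ler_nat ltnW // ltn_expl.
  have [neg|pos] := leP (1 + C - l) 0.
    apply: (@le_trans _ _ 0); last by rewrite !mulr_ge0.
    by rewrite mulr_le0_ge0.
  apply: (@le_trans _ _ ((1 + C - l) * q)); first by rewrite ler_wpM2l // ltW.
  have lC : 1 + C - l <= C * n%:R * (1 - y) by move: Cy; rewrite !mulrDr; lra.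
  apply: (@le_trans _ _ (C * n%:R * (1 - y) * q)); first by rewrite ler_wpM2r // ltW.
  rewrite -mulrA ler_wpM2l ?mulr_ge0 // mulrBl mul1r; lra.
rewrite leNgt; apply/negP => lt.
have x0 : 0 < 1 + C - l by rewrite subr_gt0.
pose z : K := C * n%:R * d%:R / (1 + C - l).
have z0 : 0 <= z by apply: divr_ge0; [by rewrite !mulr_ge0 | exact: ltW].
have zb := archi_boundP z0.
have b_gt0 : (0 < Num.bound z)%N by rewrite -(ltr0n K); apply: le_lt_trans zb.
have := bound _ b_gt0; rewrite leNgt => /negP; apply.
by rewrite [ltRHS]mulrC -ltr_pdivrMr.
Qed.

Import PowerSeries QuadricAlgebra.

Lemma codim_sum_squares_ge p n e m : prime p -> (p ^ e = (2 * m).+1)%N -> (0 < m)%N ->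
  ((p ^ e) ^ n + 2 ^ n * (euler_number n * 'C(m.-1, n)) <=
     codim (p ^ e) (sum_squares 'F_p n))%N.
Proof.
move=> p_pr qE m_gt0.
have := codim_ge (m * n.+1) (sum_squares_homogeneous (F := 'F_p) (n :=
  n)) (sum_squares_pow_eq0 n p_pr e).
rewrite qE; apply: leq_trans.
apply: leq_trans (leq_trans _ (@card_residue_pair m n _ m_gt0 erefl)) _.
  rewrite leq_add2l leq_mul2l; apply/orP; right.
  exact: leq_trans (card_strict_zigzags _ _) (card_strict_zigzags_walks _ _).
apply: subset_leq_card; apply/fintype.subsetP => a; rewrite !inE.
rewrite (_ : mpoly.mdeg (mon a) = weight a) // mpoly.mdegE.
by apply: eq_bigr => i _; rewrite monE.
Qed.

Lemma codim_growth p n : prime p -> odd p -> (0 < n)%N ->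
  let L e := codim (p ^ e) (sum_squares 'F_p n) in
  [/\ forall e, (p ^ n * L e <= L e.+1)%N,
      forall e, (L e <= 2 * (p ^ e) ^ n)%N &
      forall e, (0 < e)%N ->
        (n`! * (p ^ e) ^ n + euler_number n * (p ^ e - (2 * n).+1) ^ n <= n`! * L e)%N].
Proof.
move=> p_pr p_odd n_gt0 L; split=> [e|e|e e_gt0]; last 1 first.
- pose m := (p ^ e)./2.
  have qE : (p ^ e = (2 * m).+1)%N.
    by rewrite -[LHS]odd_double_half oddX p_odd orbT mul2n.
  have m_gt0 : (0 < m)%N.
    have : (1 < p ^ e)%N by rewrite -(expn0 p) ltn_exp2l ?prime_gt1.
    by rewrite qE; lia.
  have := codim_sum_squares_ge n p_pr qE m_gt0; rewrite -/(L e) => le.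
  apply: leq_trans (_ : n`! * ((p ^ e) ^ n + 2 ^ n * (euler_number n * 'C(m.-1,
    n))) <= _)%N.
    rewrite mulnDr leq_add2l.
    have -> : (n`! * (2 ^ n * (euler_number n * 'C(m.-1, n))) =
        euler_number n * (2 ^ n * ('C(m.-1, n) * n`!)))%N by ring.
    rewrite leq_mul2l bin_ffact; apply/orP; right.
    (* The shift is chosen to match the lower bound [(m - n) ^ n] for the falling factorial of
       [m - 1] with [n] factors, the factor [2 ^ n] being absorbed. *)
    have -> : (p ^ e - (2 * n).+1 = 2 * (m - n))%N by rewrite qE; lia.
    rewrite expnMn leq_mul2l; apply/orP; right.
    case: n n_gt0 {L le} => // n _; apply: leq_trans (expn_le_ffact m.-1 n).
    by rewrite leq_exp2r //; lia.
  by rewrite leq_mul2l le orbT.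
- have := codim_sum_squares_frob n p_pr (p ^ e); rewrite -expnS -/(L e.+1) -/(L e).
  by rewrite expnS -mulnA leq_pmul2l ?prime_gt0.
exact: codim_le.
Qed.

Theorem theorem5p9 (K : realType) (p n : nat)
    (p_prime : prime p) (p_ge3 : (3 <= p)%N) (n_ge2 : (2 <= n)%N) :
  1 + (euler_number n)%:R / (n`!)%:R <= hilbert_kunz K p (quadric_local p n).
Proof.
have p_odd : odd p by have := even_prime p_prime; case=> // p2; rewrite p2 in p_ge3.
have [Linc Lub Llb] := codim_growth p_prime p_odd (ltnW n_ge2).
have := limn_ge_of_growth K (prime_gt1 p_prime) Linc Lub Llb.
rewrite /hilbert_kunz (_ : krull_dim (quadric_local p n) = n); last first.
  exact: krull_dim_quadric.
set a := (X in limn X); set b := (X in _ -> is_true (_ <= limn X)).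
suff -> : b = a by [].
by apply: funext => e; rewrite /b quadric_length.
Qed.
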